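(* For all positive integers $m$ and $p$, $$\sum_{n=1}^\infty\frac{T_n(\{1\}_{2m-1})\,T_n(\{1\}_{2p-1})}{n}(-1)^n=(-1)^m\sum_{j=1}^pW(2j+2m-1,2m)\,Z(j,p).$$
   Context: $\{1\}_a$ denotes the sequence of $a$ ones. For $n\ge1$, $a\ge1$: $T_n(\{1\}_{2a-1})=\sum\frac{2^{2a-1}}{(2n_1-1)(2n_2)(2n_3-1)\cdots(2n_{2a-2})(2n_{2a-1}-1)}$, summed over integers $0<n_1\le n_2<n_3\le n_4<\cdots\le n_{2a-2}<n_{2a-1}\le n$. For positive integers $k_1,\dots,k_r$, $\bar T(k_1,\ldots,k_r):=2^r\sum_{0<n_1<\cdots<n_r}\frac{(-1)^{n_r}}{(2n_1-1)^{k_1}(2n_2-2)^{k_2}\cdots(2n_r-r)^{k_r}}$. $I(k,r)$ is the set of tuples of positive integers $(k_1,\dots,k_r)$ with sum $k$; $W(k,r):=\sum_{(k_1,\dots,k_r)\in I(k,r)}\bar T(k_1,\dots,k_r)$. $\bar\zeta(s):=\sum_{n\ge1}(-1)^{n-1}n^{-s}$ for $s\ge1$, $\bar\zeta(0):=1/2$. For $1\le j\le p$: $Z(p,p):=1$ and for $j<p$, $Z(j,p):=\sum_{k=1}^{p-j}(-2)^k\sum_{j=i_0<i_1<\cdots<i_k=p}\prod_{l=1}^k\bar\zeta(2i_l-2i_{l-1})$. *)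

(* Defs.v *)
From HB Require Import structures.
From mathcomp Require Import all_boot all_order all_algebra.
From mathcomp Require Import all_classical all_reals all_analysis.
Set Implicit Arguments. Unset Strict Implicit. Unset Printing Implicit Defensive.
Import Order.TTheory GRing.Theory Num.Theory.
Local Open Scope ring_scope.

Section Defs.
Variable R : realType.

(* ta l m = sum over 0<n_1<=n_2<n_3<=n_4<...  (l variables) with n_l = m of
   1/((2n_1-1)(2n_2)(2n_3-1)...) : odd-indexed factors 2n_i-1, even-indexed 2n_i;
   n_{2i-1} <= n_{2i} and n_{2i} < n_{2i+1}. *)
Fixpoint ta (l m : nat) : R :=
  match l with
  | 0 => 1
  | l'.+1 =>
      (if odd l then ((2 * m - 1)%N%:R)^-1 else ((2 * m)%N%:R)^-1) *
      (if l' is 0 then 1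
       else \sum_(1 <= n < (if odd l then m else m.+1)) ta l' n)
  end.

Definition Tones (n a : nat) : R :=
  2 ^+ (2 * a - 1) * \sum_(1 <= m < n.+1) ta (2 * a - 1) m.

(* tb rk m, with rk = rev [:: k_1; ...; k_l]: sum over 0<n_1<...<n_l = m of
   prod_i 1/(2n_i - i)^{k_i}. *)
Fixpoint tb (rk : seq nat) (m : nat) : R :=
  match rk with
  | [::] => 1
  | k :: rk' =>
      (((2 * m - (size rk').+1)%N%:R) ^+ k)^-1 *
      (if rk' is [::] then 1 else \sum_(1 <= n < m) tb rk' n)
  end.

Definition Tbar (ks : seq nat) : R :=
  2 ^+ size ks *
  limn (fun N : nat => \sum_(1 <= m < N.+1) (-1) ^+ m * tb (rev ks) m).

Definition W (k r : nat) : R :=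
  \sum_(t : r.-tuple 'I_k.+1 |
          all (fun x => 0 < x)%N (map val t) && (sumn (map val t) == k))
     Tbar (map val t).

Definition zetabar (s : nat) : R :=
  if s == 0%N then 2^-1
  else limn (fun N : nat =>
              \sum_(1 <= n < N.+1) (-1) ^+ n.-1 * ((n%:R : R) ^+ s)^-1).

(* Z(j,p): chains j = i_0 < i_1 < ... < i_k = p encoded as (k+1)-tuples *)
Definition Z (j p : nat) : R :=
  if j == p then 1
  else \sum_(1 <= k < (p - j).+1)
         (-2) ^+ k *
         \sum_(s : k.+1.-tuple 'I_p.+1 |
                 [&& nth 0%N (map val s) 0 == j,
                     nth 0%N (map val s) k == p &
                     sorted ltn (map val s)])
            \prod_(1 <= l < k.+1)
               zetabar (2 * nth 0%N (map val s) l - 2 * nth 0%N (map val s) l.-1).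

End Defs.

(* Main.v *)
Require Import Defs.
From HB Require Import structures.
From mathcomp Require Import all_boot all_order all_algebra.
From mathcomp Require Import all_classical all_reals all_analysis.
From mathcomp Require Import ring lra zify.
Set Implicit Arguments.
Unset Strict Implicit.
Unset Printing Implicit Defensive.
Import Order.TTheory GRing.Theory Num.Theory.
Import numFieldNormedType.Exports.
Local Open Scope classical_set_scope.
Local Open Scope ring_scope.

(** Substitute u = e^-t and x = tanh (t/2) = (1 - u)/(1 + u), for t >= 0. The
    numbers b_q(k), the integrals of (x^k)' t^q/q! over t >= 0, satisfy
    b_q(k+2) = b_q(k) + 2/(k+1) b_(q-1)(k+1) and b_q(1) = 2 zetabar(q), and for
    fixed parity this is the recurrence of T_n({1}_i) in (2n, i). Hence b_(2j-1)(2n)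
    is the sum over i of 2 zetabar(2j-2i) T_n({1}_(2i-1)), and Z(j,p) is the inverse of
    that triangular Toeplitz matrix. It remains to prove, for r = 2m, that
    the alternating series of T_n({1}_(r-1)) b_q(2n) / n sums to
    (-1)^m W(q+r, r). Expand the iterated integral of u^-y against r
    copies of 2 dx/(1+x^2) = -2 du/(1+u^2), once in powers of x and once in
    powers of u: the coefficient of y^q is the left-hand side in the first
    expansion and the right-hand side in the second. The two expansions are
    truncated at order n, and the error, a combination of x^n and u^n times
    powers of t with coefficients O(n^(1/2)), has integral O(n^(-1/4)). *)

Section ImproperIntegral.
Variable R : realType.
Implicit Types (g h G H : R -> R) (t s x I J c : R).

Definition improper_integral g (I : R) :=
  exists G, [/\ forall t, 0 <= t -> is_derive t 1 G (g t),
    G 0 = 0 & G t @[t --> +oo] --> I].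

Lemma improper_integral_ext g h I : (forall t, 0 <= t -> g t = h t) ->
  improper_integral g I -> improper_integral h I.
Proof.
move=> gh [G [dG G0 GI]]; exists G; split=> // t t0.
by rewrite -gh//; exact: dG.
Qed.

Lemma improper_integral_antiderivative G g l :
  (forall t, 0 <= t -> is_derive t 1 G (g t)) -> G t @[t --> +oo] --> l ->
  improper_integral g (l - G 0).
Proof.
move=> dG Gl; exists (fun t => G t - G 0); split.
- move=> t t0; have := dG t t0 => dGt.
  have := @is_deriveB _ _ _ G (cst (G 0)) t 1 _ _ dGt (is_derive_cst _ _ _).
  by rewrite subr0.
- by rewrite subrr.
- by apply: cvgB => //; exact: cvg_cst.
Qed.

Lemma improper_integral0 : improper_integral (fun=> 0) 0.
Proof.
exists (fun=> 0); split=> //; last exact: cvg_cst.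
by move=> t _; exact: is_derive_cst.
Qed.

Lemma improper_integralD g h I J : improper_integral g I ->
  improper_integral h J -> improper_integral (fun t => g t + h t) (I + J).
Proof.
move=> [G [dG G0 GI]] [H [dH H0 HJ]]; exists (fun t => G t + H t); split.
- by move=> t t0; have ? := dG t t0; have ? := dH t t0; exact: is_deriveD.
- by rewrite G0 H0 addr0.
- exact: cvgD.
Qed.

Lemma improper_integralZ c g I : improper_integral g I ->
  improper_integral (fun t => c * g t) (c * I).
Proof.
move=> [G [dG G0 GI]]; exists (fun t => c * G t); split.
- by move=> t t0; have ? := dG t t0; exact: (@is_deriveZ _ _ _ G c).
- by rewrite G0 mulr0.
- by apply: cvgM => //; exact: cvg_cst.
Qed.

Lemma improper_integral_sum (T : Type) (r : seq T) (P : pred T)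
    (g : T -> R -> R) (I : T -> R) :
  (forall i, P i -> improper_integral (g i) (I i)) ->
  improper_integral (fun t => \sum_(i <- r | P i) g i t) (\sum_(i <- r | P i) I i).
Proof.
move=> gI; elim: r => [|x r IH].
  rewrite big_nil; apply: improper_integral_ext improper_integral0 => t _.
  by rewrite big_nil.
rewrite big_cons; case: ifP => Px.
  apply: improper_integral_ext (improper_integralD (gI _ Px) IH) => t _.
  by rewrite big_cons Px.
by apply: improper_integral_ext IH => t _; rewrite big_cons Px.
Qed.

Lemma le_antiderivative G g H h : (forall t, 0 <= t -> is_derive t 1 G (g t)) ->
  (forall t, 0 <= t -> is_derive t 1 H (h t)) ->
  (forall t, 0 <= t -> g t <= h t) -> forall t s, 0 <= s -> s <= t ->
  G t - G s <= H t - H s.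
Proof.
move=> dG dH gh t s s0 st.
have dHG x : 0 <= x -> is_derive x 1 (H - G) (h x - g x).
  by move=> x0; have ? := dG x x0; have ? := dH x x0; exact: is_deriveB.
suff : (H - G) s <= (H - G) t by rewrite !fctE; lra.
apply: (@ger0_derive1_ndecr _ (H - G) s t) => //.
- move=> x; rewrite in_itv /= => /andP[sx _].
  by have := dHG x (ltW (le_lt_trans s0 sx)) => ?; exact: ex_derive.
- move=> x; rewrite in_itv /= => /andP[sx _].
  have x0 := ltW (le_lt_trans s0 sx); have := dHG x x0 => ?.
  by rewrite derive1E derive_val subr_ge0 gh.
- apply: derivable_within_continuous => x; rewrite in_itv /= => /andP[sx _].
  by have := dHG x (le_trans s0 sx) => ?; exact: ex_derive.
Qed.

Lemma ndecr_antiderivative G g : (forall t, 0 <= t -> is_derive t 1 G (g t)) ->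
  (forall t, 0 <= t -> 0 <= g t) -> forall s t, 0 <= s -> s <= t -> G s <= G t.
Proof.
move=> dG g0 s t s0 st; rewrite -subr_ge0.
have d0 t' : 0 <= t' -> is_derive t' 1 (cst (0 : R)) 0.
  by move=> _; exact: is_derive_cst.
by have := le_antiderivative d0 dG g0 s0 st; rewrite subrr.
Qed.

Lemma improper_integral_le g h I J : (forall t, 0 <= t -> g t <= h t) ->
  improper_integral g I -> improper_integral h J -> I <= J.
Proof.
move=> gh [G [dG G0 GI]] [H [dH H0 HJ]].
apply: (ler_cvg_to GI HJ); near=> t.
have t0 : 0 <= t by near: t; exact: nbhs_pinfty_ge.
by have := le_antiderivative dG dH gh (lexx 0) t0; rewrite G0 H0 !subr0.
Unshelve. all: by end_near. Qed.

Lemma improper_integral_norm_le g h I J : (forall t, 0 <= t -> `|g t| <= h t) ->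
  improper_integral g I -> improper_integral h J -> `|I| <= J.
Proof.
move=> gh gI hJ; rewrite ler_norml; apply/andP; split; last first.
  apply: improper_integral_le gI hJ => t t0.
  exact: le_trans (ler_norm _) (gh t t0).
rewrite -mulN1r; apply: improper_integral_le (improper_integralZ (-1) hJ) gI.
by move=> t t0; rewrite mulN1r; have := gh t t0; rewrite ler_norml => /andP[].
Qed.

Lemma antiderivative_exists g : continuous g ->
  exists G, (forall t, 0 <= t -> is_derive t 1 G (g t)) /\ G 0 = 0.
Proof.
move=> cg.
pose F x := (\int[lebesgue_measure]_(t in [set` `[(-1)%R, x]]) (g t))%R.
exists (fun t => F t - F 0); rewrite subrr; split=> // t t0.
have int_g : lebesgue_measure.-integrable `[(-1)%R, (t + 1)%R] (EFin \o g).
  apply: continuous_compact_integrable; first exact: segment_compact.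
  exact: continuous_subspaceT.
have tt1 : t < t + 1 by rewrite ltrDl.
have lt_N1t : -1 < t by lra.
have [dF Fg] := continuous_FTC1_closed tt1 int_g lt_N1t (cg t).
have dFt : is_derive t 1 F (g t) by apply: DeriveDef => //; rewrite -derive1E.
have := @is_deriveB _ _ _ F (cst (F 0)) t 1 _ _ dFt (is_derive_cst _ _ _).
by rewrite subr0.
Qed.

Lemma improper_integral_exists g h J : continuous g ->
  (forall t, 0 <= t -> 0 <= g t <= h t) -> improper_integral h J ->
  exists I, improper_integral g I.
Proof.
move=> cg gh [H [dH H0 HJ]].
have [G [dG G0]] := antiderivative_exists cg.
have ndG s t : 0 <= s -> s <= t -> G s <= G t.
  by apply: (ndecr_antiderivative dG) => x x0; have /andP[] := gh x x0.
have ndH s t : 0 <= s -> s <= t -> H s <= H t.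
  apply: (ndecr_antiderivative dH) => x x0.
  by have /andP[] := gh x x0; exact: le_trans.
pose K t := G (Num.max 0 t).
have ndK : nondecreasing_fun K.
  move=> s t st; apply: ndG; first by rewrite le_max lexx.
  by rewrite ge_max !le_max lexx st orbT.
have bK : has_ubound (range K).
  exists J => _ [t _ <-]; rewrite /K; set s := Num.max 0 t.
  have s0 : 0 <= s by rewrite le_max lexx.
  have GH : G s <= H s.
    have := @le_antiderivative G g H h dG dH _ s 0 (lexx 0) s0.
    by rewrite G0 H0 !subr0; apply=> x x0; have /andP[] := gh x x0.
  apply: le_trans GH _; apply: (ler_cvg_to (@cvg_cst _ (H s) _ _ _) HJ).
  by near=> x; apply: ndH => //; near: x; exact: nbhs_pinfty_ge.
exists (sup (range K)), G; split=> //.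
apply: cvg_trans (nondecreasing_cvgr ndK bK); apply: near_eq_cvg.
near=> t; rewrite /K max_r//; near: t; exact: nbhs_pinfty_ge.
Unshelve. all: by end_near. Qed.

End ImproperIntegral.

Section RealDerivatives.
Variable R : realType.
Implicit Types (f g : R -> R) (t a b c : R).

Lemma is_derive1D f g t a b : is_derive t 1 f a -> is_derive t 1 g b ->
  is_derive t 1 (fun x => f x + g x) (a + b).
Proof. by move=> ? ?; exact: is_deriveD. Qed.

Lemma is_derive1M f g t a b : is_derive t 1 f a -> is_derive t 1 g b ->
  is_derive t 1 (fun x => f x * g x) (a * g t + f t * b).
Proof.
move=> ? ?; apply: (@is_derive_eq _ _ _ (f * g)).
by rewrite addrC /GRing.scale /= mulrC.
Qed.

Lemma is_derive1Z c g t b : is_derive t 1 g b ->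
  is_derive t 1 (fun x => c * g x) (c * b).
Proof. by move=> ?; exact: (@is_deriveZ _ _ _ g c). Qed.

Lemma is_derive1X f n t a : is_derive t 1 f a ->
  is_derive t 1 (fun x => f x ^+ n) (n%:R * f t ^+ n.-1 * a).
Proof.
move=> df; have := is_deriveX n df; rewrite /GRing.scale /=.
by congr is_derive; apply/funext => x; rewrite exprfctE.
Qed.

Lemma is_derive1_sum (T : Type) (r : seq T) (P : pred T) (h : T -> R -> R)
    (dh : T -> R) t : (forall i, is_derive t 1 (h i) (dh i)) ->
  is_derive t 1 (fun x => \sum_(i <- r | P i) h i x) (\sum_(i <- r | P i) dh i).
Proof.
move=> dhi; elim: r => [|y r IH].
  rewrite big_nil; under eq_fun do rewrite big_nil; exact: is_derive_cst.
rewrite big_cons; case: ifP => Py; under eq_fun do rewrite big_cons Py.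
  exact: is_derive1D.
exact: IH.
Qed.

End RealDerivatives.

Section Substitution.
Variable R : realType.
Implicit Types t : R.

(* [tanh2 t] is tanh (t/2), and [sech t] is the density with respect to dt of
   2 dx/(1+x^2) = - 2 du/(1+u^2), where x = tanh2 t and u = expN t. *)
Definition expN t : R := expR (- t).
Definition tanh2 t : R := (1 - expN t) / (1 + expN t).
Definition sech t : R := 2 * expN t / (1 + expN t ^+ 2).
Definition monom i t : R := t ^+ i / i`!%:R.

Lemma expN_gt0 t : 0 < expN t. Proof. exact: expR_gt0. Qed.

Lemma expN_le1 t : 0 <= t -> expN t <= 1.
Proof. by move=> t0; rewrite /expN expR_le1 oppr_le0. Qed.

Lemma expN0 : expN 0 = 1. Proof. by rewrite /expN oppr0 expR0. Qed.

Lemma tanh2_0 : tanh2 0 = 0. Proof. by rewrite /tanh2 expN0 subrr mul0r. Qed.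

Lemma expN_cvg : expN t @[t --> +oo] --> 0. Proof. exact: cvgr_expR. Qed.

Lemma tanh2_ge0 t : 0 <= t -> 0 <= tanh2 t.
Proof.
move=> t0; have u0 := expN_gt0 t; have u1 := expN_le1 t0.
by rewrite divr_ge0// ?subr_ge0// addr_ge0// ltW.
Qed.

Lemma one_sub_tanh2 t : 1 - tanh2 t = 2 * expN t / (1 + expN t).
Proof. by rewrite /tanh2; have := expN_gt0 t => ?; field; lra. Qed.

Lemma tanh2_le1 t : tanh2 t <= 1.
Proof.
rewrite -subr_ge0 one_sub_tanh2; have := expN_gt0 t => ?.
by rewrite divr_ge0//; lra.
Qed.

Lemma one_sub_tanh2_le t : 1 - tanh2 t <= 2 * expN t.
Proof.
rewrite one_sub_tanh2; have := expN_gt0 t => u0.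
by rewrite ler_pdivrMr; nra.
Qed.

Lemma sech_ge0 t : 0 <= sech t.
Proof. by have := expN_gt0 t => ?; rewrite divr_ge0//; nra. Qed.

Lemma sech_le t : sech t <= 2 * expN t.
Proof.
have u0 := expN_gt0 t; rewrite /sech ler_pdivrMr; last nra.
by rewrite ler_peMr//; nra.
Qed.

Lemma sech_expN t : sech t * (1 + expN t ^+ 2) = 2 * expN t.
Proof. by rewrite /sech; have := expN_gt0 t => ?; field; nra. Qed.

Lemma sech_tanh2 t : sech t * (1 + tanh2 t ^+ 2) = 1 - tanh2 t ^+ 2.
Proof.
by rewrite /sech /tanh2; have := expN_gt0 t => ?; field; apply/andP; split; nra.
Qed.

Lemma monom_ge0 i t : 0 <= t -> 0 <= monom i t.
Proof. by move=> t0; rewrite divr_ge0// exprn_ge0. Qed.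

Lemma monom0 i : monom i 0 = (i == 0)%:R.
Proof. by case: i => [|i]; rewrite /monom ?expr0 ?fact0 ?divr1// expr0n mul0r. Qed.

Lemma monom0n t : monom 0 t = 1. Proof. by rewrite /monom expr0 fact0 divr1. Qed.

Lemma is_derive_expN t : is_derive t 1 expN (- expN t).
Proof.
have := @is_derive1_comp _ expR -%R t _ _ (is_derive_expR _) (is_deriveNid _ _).
by rewrite mulrN1.
Qed.

Lemma is_derive_tanh2 t : is_derive t 1 tanh2 ((1 - tanh2 t ^+ 2) / 2).
Proof.
have du := is_derive_expN t; have u0 := expN_gt0 t.
have dn : is_derive t 1 (fun x => 1 + -1 * expN x) (0 + -1 * (- expN t)).
  by apply: is_derive1D.
have dd : is_derive t 1 (fun x => 1 + expN x) (0 + - expN t).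
  by apply: is_derive1D => //; exact: is_derive_cst.
have d0 : 1 + expN t != 0 by lra.
have := is_derive1M dn (@is_deriveV _ (fun x => 1 + expN x) _ _ _ d0 dd).
have -> : (fun x => (1 + -1 * expN x) * (1 + expN x)^-1) = tanh2.
  by apply/funext => x; rewrite mulN1r.
move=> dX; apply: (is_derive_eq dX).
by rewrite /tanh2 /GRing.scale /=; field.
Qed.

Lemma is_derive_tanh2X k t : is_derive t 1 (fun x => tanh2 x ^+ k)
  (k%:R * tanh2 t ^+ k.-1 * ((1 - tanh2 t ^+ 2) / 2)).
Proof. by apply: is_derive1X; exact: is_derive_tanh2. Qed.

Lemma is_derive_expNX k t : is_derive t 1 (fun x => expN x ^+ k)
  (- k%:R * expN t ^+ k).
Proof.
apply: (is_derive_eq (is_derive1X k (is_derive_expN t))).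
by case: k => [|k]; rewrite ?mulr0n ?oppr0 ?mul0r// exprSr; ring.
Qed.

Definition monom_pred i t : R := if i is i'.+1 then monom i' t else 0.

Lemma is_derive_monom i t : is_derive t 1 (monom i) (monom_pred i t).
Proof.
have := is_derive1Z (i`!%:R^-1) (is_derive1X i (is_derive_id t 1)).
have -> : (fun x : R => i`!%:R^-1 * x ^+ i) = monom i.
  by apply/funext => x; rewrite mulrC.
move=> dm; apply: (is_derive_eq dm).
case: i dm => [|i] _ /=; first by rewrite !mul0r mulr0.
have i0 : i.+1%:R != 0 :> R by rewrite pnatr_eq0.
have f0 : i`!%:R != 0 :> R by rewrite pnatr_eq0 -lt0n fact_gt0.
by rewrite /monom factS natrM; field; rewrite f0 nat1r i0.
Qed.

Lemma expN_monom_cvg0 i : expN t * monom i t @[t --> +oo] --> 0.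
Proof.
have inv_cvg : i.+1%:R * t^-1 @[t --> +oo] --> (i.+1%:R * 0 : R).
  apply: cvgM; first exact: cvg_cst.
  by apply/(@gtr0_cvgV0 _ _ _ _ id) => //; exact: nbhs_pinfty_gt.
rewrite mulr0 in inv_cvg.
apply: (squeeze_cvgr _ (@cvg_cst _ (0 : R) _ _ _) inv_cvg).
near=> t; have t0 : 0 < t by near: t; exact: nbhs_pinfty_gt.
rewrite mulr_ge0 ?monom_ge0 ?(ltW t0) ?(ltW (expN_gt0 _))//=.
have f0 : (0 : R) < i`!%:R by rewrite ltr0n fact_gt0.
rewrite /expN expRN mulrC ler_pdivrMr ?expR_gt0// mulrAC ler_pdivlMr//.
have := expR_ge1Dxn i (ltW t0); rewrite factS natrM invfM => le_exp.
have : t ^+ i.+1 * (i.+1%:R^-1 * i`!%:R^-1) <= expR t.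
  by apply: le_trans le_exp; rewrite lerDr ler01.
rewrite mulrCA ler_pdivrMl ?ltr0n//; apply: le_trans.
by rewrite /monom exprSr mulrAC.
Unshelve. all: by end_near. Qed.

Lemma expNX_monom_cvg0 a i :
  expN t ^+ a.+1 * monom i t @[t --> +oo] --> 0.
Proof.
apply: (squeeze_cvgr _ (@cvg_cst _ (0 : R) _ _ _) (@expN_monom_cvg0 i)).
near=> t; have t0 : 0 <= t by near: t; exact: nbhs_pinfty_ge.
rewrite mulr_ge0 ?monom_ge0 ?exprn_ge0 ?(ltW (expN_gt0 _))//=.
rewrite ler_wpM2r ?monom_ge0// exprS ler_piMr ?(ltW (expN_gt0 _))//.
by rewrite exprn_ile1 ?expN_le1// ltW// expN_gt0.
Unshelve. all: by end_near. Qed.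

Lemma tanh2_cvg1 : tanh2 t @[t --> +oo] --> (1 : R).
Proof.
rewrite -[X in _ --> X](_ : (1 - 0) / (1 + 0) = 1 :> R); last first.
  by rewrite subr0 addr0 divr1.
apply: cvgM; first by apply: cvgB expN_cvg; exact: cvg_cst.
apply: cvgV; first by rewrite addr0.
by apply: cvgD expN_cvg; exact: cvg_cst.
Qed.

Lemma is_derive_expNX_monom a i t :
  is_derive t 1 (fun x => expN x ^+ a * monom i x)
    (- a%:R * (expN t ^+ a * monom i t) + expN t ^+ a * monom_pred i t).
Proof.
have := is_derive1M (is_derive_expNX a t) (is_derive_monom i t).
by move=> d; apply: (is_derive_eq d); rewrite [in RHS]mulrA.
Qed.

Lemma integral_expNX_monom a i :
  improper_integral (fun t => expN t ^+ a.+1 * monom i t)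
    (a.+1%:R ^+ i.+1)^-1.
Proof.
have a0 : a.+1%:R != 0 :> R by rewrite pnatr_eq0.
elim: i => [|i IH].
  have := improper_integral_antiderivative
    (fun t _ => is_derive_expNX_monom a.+1 0 t) (expNX_monom_cvg0 a 0).
  move=> /(improper_integralZ (- a.+1%:R^-1)).
  rewrite expN0 expr1n monom0 eqxx mul1r sub0r mulrNN mulr1 expr1.
  by apply: improper_integral_ext => t _; rewrite /monom_pred; field.
have := improper_integral_antiderivative
    (fun t _ => is_derive_expNX_monom a.+1 i.+1 t) (expNX_monom_cvg0 a i.+1).
move=> /(improper_integralZ (- a.+1%:R^-1)).
rewrite expN0 expr1n monom0 mul1r subr0 mulr0.
move/(improper_integralD (improper_integralZ a.+1%:R^-1 IH)).
rewrite addr0 -invfM -exprS.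
by apply: improper_integral_ext => t _; rewrite /monom_pred; field.
Qed.

Lemma one_sub_tanh2_geometric t n :
  1 - tanh2 t = \sum_(1 <= c < n.+1) 2 * (-1) ^+ c.-1 * expN t ^+ c
     + 2 * (-1) ^+ n * expN t ^+ n.+1 / (1 + expN t).
Proof.
have d0 : 1 + expN t != 0 by have := expN_gt0 t; lra.
elim: n => [|n IH].
  by rewrite big_geq// add0r one_sub_tanh2 expr0 expr1 mulr1.
rewrite IH [in RHS]big_nat_recr//= -addrA; congr (_ + _).
by rewrite !exprS; field.
Qed.

Lemma one_sub_tanh2_monom_continuous i :
  continuous (fun t => (1 - tanh2 t) * monom i t).
Proof.
move=> t; apply: differentiable_continuous; apply/derivable1_diffP.
have d1 : is_derive t 1 (fun x => 1 + -1 * tanh2 x)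
    (0 + -1 * ((1 - tanh2 t ^+ 2) / 2)).
  by have ? := is_derive_tanh2 t; apply: is_derive1D.
have := is_derive1M d1 (is_derive_monom i t).
under eq_fun do rewrite mulN1r; move=> ?; exact: ex_derive.
Qed.

Lemma integral_zetabar q :
  improper_integral (fun t => (1 - tanh2 t) * monom q t) (2 * zetabar R q.+1).
Proof.
have [] := @improper_integral_exists _ (fun t => (1 - tanh2 t) * monom q t)
  (fun t => 2 * (expN t ^+ 1 * monom q t)) (2 * (1%:R ^+ q.+1)^-1).
- exact: one_sub_tanh2_monom_continuous.
- move=> t t0; rewrite mulr_ge0 ?subr_ge0 ?tanh2_le1 ?monom_ge0//= expr1 mulrA.
  by rewrite ler_wpM2r ?monom_ge0// one_sub_tanh2_le.
- by apply: improper_integralZ; exact: integral_expNX_monom.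
move=> I intI; suff <- : I = 2 * zetabar R q.+1 by [].
suff cvgI : (fun N => \sum_(1 <= n < N.+1)
    (-1) ^+ n.-1 * ((n%:R : R) ^+ q.+1)^-1) @ \oo --> 2^-1 * I.
  rewrite /zetabar/= (cvg_lim _ cvgI)// mulrA divff ?mul1r//.
pose S n : R := \sum_(1 <= c < n.+1) (-1) ^+ c.-1 * ((c%:R : R) ^+ q.+1)^-1.
have bound n : `|I - 2 * S n| <= 2 * (n.+1%:R ^+ q.+1)^-1.
  have intS : improper_integral (fun t => \sum_(1 <= c < n.+1)
      2 * (-1) ^+ c.-1 * (expN t ^+ c * monom q t)) (2 * S n).
    rewrite mulr_sumr big_add1 /=; under eq_bigr do rewrite mulrA.
    apply: (improper_integral_ext (g := fun t => \sum_(0 <= c < n)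
        2 * (-1) ^+ c * (expN t ^+ c.+1 * monom q t))).
      by move=> t _; rewrite [RHS]big_add1.
    apply: improper_integral_sum => c _; apply: improper_integralZ.
    exact: integral_expNX_monom.
  have := improper_integralD intI (improper_integralZ (-1) intS).
  rewrite mulN1r => intIS.
  apply: (improper_integral_norm_le _ intIS
    (improper_integralZ 2 (integral_expNX_monom n q))) => t t0.
  rewrite (one_sub_tanh2_geometric t n) mulrDl mulr_suml mulN1r.
  under eq_bigr do rewrite -mulrA.
  rewrite addrAC subrr add0r normrM (ger0_norm (monom_ge0 _ t0)) mulrA.
  rewrite ler_wpM2r ?monom_ge0//.
  have u0 := expN_gt0 t.
  rewrite !normrM normfV normrX normrN1 expr1n mulr1 normr_nat normrX.
  rewrite !ger0_norm ?addr_ge0 ?(ltW u0)//.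
  rewrite ler_pdivrMr; last by lra.
  by rewrite ler_peMr ?mulr_ge0 ?exprn_ge0 ?(ltW u0)//; lra.
apply/cvgrPdist_le => e e0; near=> n.
have -> : 2^-1 * I - S n = 2^-1 * (I - 2 * S n) by field.
rewrite normrM ger0_norm// ler_pdivrMl//.
apply: le_trans (bound n) _; rewrite ler_wpM2l//.
apply: (@le_trans _ _ n.+1%:R^-1).
  by rewrite lef_pV2 ?posrE ?exprn_gt0 ?ltr0n// exprS ler_peMr// exprn_ege1// ler1n.
near: n; have := @cvg_harmonic R => /cvgrPdist_le /(_ e e0); apply: filterS => n.
by rewrite sub0r normrN; apply: le_trans; exact: ler_norm.
Unshelve. all: by end_near. Qed.

End Substitution.

Section Moments.
Variable R : realType.

Fixpoint two_step (x0 x1 : nat -> R) (k q : nat) : R :=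
  match k with
  | 0 => x0 q
  | k'.+1 => if k' is k''.+1 then
      two_step x0 x1 k'' q +
      (if q is q'.+1 then 2 / k'%:R * two_step x0 x1 k' q' else 0)
    else x1 q
  end.

Lemma two_stepSS x0 x1 k q : two_step x0 x1 k.+2 q = two_step x0 x1 k q +
  (if q is q'.+1 then 2 / k.+1%:R * two_step x0 x1 k.+1 q' else 0).
Proof. by []. Qed.

Lemma two_step_ind (P : nat -> Prop) :
  P 0%N -> P 1%N -> (forall k, P k -> P k.+1 -> P k.+2) -> forall k, P k.
Proof.
move=> P0 P1 PSS k; suff [] : P k /\ P k.+1 by [].
by elim: k => [//|k [Pk PSk]]; split=> //; exact: PSS.
Qed.

Definition tanh_moment := two_step (fun q => (q == 0)%:R) (fun q => 2 * zetabar R q).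

Definition dtanh2X k (t : R) : R :=
  k%:R * tanh2 t ^+ k.-1 * ((1 - tanh2 t ^+ 2) / 2).

Lemma dtanh2X_ge0 k t : 0 <= t -> 0 <= dtanh2X k t.
Proof.
move=> t0; have X0 := tanh2_ge0 t0; have X1 := tanh2_le1 t.
by rewrite !mulr_ge0 ?exprn_ge0// subr_ge0 expr_le1.
Qed.

Lemma tanh2X_diff_monom_cvg0 k q :
  (tanh2 t ^+ k.+2 - tanh2 t ^+ k) * monom q t @[t --> +oo] --> (0 : R).
Proof.
have cvg_mul c : c * (expN t * monom q t) @[t --> +oo] --> (0 : R).
  rewrite -(mulr0 c); apply: cvgM (@expN_monom_cvg0 R q); exact: cvg_cst.
apply: (squeeze_cvgr _ (cvg_mul (- 4)) (cvg_mul 4)).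
near=> t; have t0 : 0 <= t by near: t; exact: nbhs_pinfty_ge.
rewrite mulNr -ler_norml normrM (ger0_norm (monom_ge0 _ t0)) [leRHS]mulrA.
rewrite ler_wpM2r ?monom_ge0//.
have X0 := tanh2_ge0 t0; have X1 := tanh2_le1 t.
have -> : tanh2 t ^+ k.+2 - tanh2 t ^+ k =
    - (tanh2 t ^+ k * ((1 - tanh2 t) * (1 + tanh2 t))) by rewrite !exprS; ring.
rewrite normrN ger0_norm; last by rewrite !mulr_ge0 ?exprn_ge0//; lra.
apply: (@le_trans _ _ ((1 - tanh2 t) * (1 + tanh2 t))).
  by rewrite ler_piMl ?exprn_ile1// mulr_ge0//; lra.
by have := one_sub_tanh2_le t; nra.
Unshelve. all: by end_near. Qed.

Lemma integral_dtanh2X_monom k q :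
  improper_integral (fun t => dtanh2X k t * monom q t)
    (tanh_moment k q - ((k == 0) && (q == 0))%:R).
Proof.
elim/two_step_ind: k q => [|[|q]|k IHk IHSk q].
- move=> q; rewrite /= subrr.
  apply: improper_integral_ext (improper_integral0 R) => t _.
  by rewrite /dtanh2X !mul0r.
- have := improper_integral_antiderivative (fun t _ => is_derive_tanh2 t) (@tanh2_cvg1 R).
  rewrite tanh2_0 /tanh_moment /= /zetabar eqxx mulfV// !subr0.
  apply: improper_integral_ext => t _.
  by rewrite monom0n mulr1 /dtanh2X expr0 mul1r mul1r.
- have dG (t : R) : 0 <= t -> is_derive t 1 (fun x => (tanh2 x + -1) * monom q.+1 x)
      ((dtanh2X 1 t + 0) * monom q.+1 t + (tanh2 t + -1) * monom q t).
    move=> _; apply: is_derive1M (is_derive_monom _ _); apply: is_derive1D.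
    apply: (is_derive_eq (is_derive_tanh2 t)).
    by rewrite /dtanh2X expr0 mul1r mul1r.
  have cvgG : (tanh2 t + -1) * monom q.+1 t @[t --> +oo] --> (0 : R).
    have cvgu : -2 * (expN t * monom q.+1 t) @[t --> +oo] --> (-2 * 0 : R).
      by apply: cvgM; [exact: cvg_cst|exact: expN_monom_cvg0].
    rewrite mulr0 in cvgu.
    apply: (squeeze_cvgr _ cvgu (@cvg_cst _ (0 : R) _ _ _)).
    near=> t; have t0 : 0 <= t by near: t; exact: nbhs_pinfty_ge.
    rewrite [-2 * _]mulrA; apply/andP; split.
      by rewrite ler_wpM2r ?monom_ge0//; have := one_sub_tanh2_le t; lra.
    by rewrite mulr_le0_ge0 ?monom_ge0// subr_le0 tanh2_le1.
  have := improper_integral_antiderivative dG cvgG.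
  rewrite monom0 mulr0 subr0 => /improper_integralD /(_ (integral_zetabar R q)).
  rewrite add0r subr0; apply: improper_integral_ext => t _; ring.
have dG (t : R) : 0 <= t ->
    is_derive t 1 (fun x => (tanh2 x ^+ k.+2 + -1 * tanh2 x ^+ k) * monom q x)
    ((dtanh2X k.+2 t + -1 * dtanh2X k t) * monom q t +
     (tanh2 t ^+ k.+2 + -1 * tanh2 t ^+ k) * monom_pred q t).
  move=> _; apply: is_derive1M (is_derive_monom _ _).
  apply: is_derive1D; first exact: is_derive_tanh2X.
  by apply: is_derive1Z; exact: is_derive_tanh2X.
have cvgG : (tanh2 t ^+ k.+2 + -1 * tanh2 t ^+ k) * monom q t @[t --> +oo] --> (0 : R).
  by under eq_fun do rewrite mulN1r; exact: tanh2X_diff_monom_cvg0.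
have intG := improper_integralD (IHk q) (improper_integral_antiderivative dG cvgG).
rewrite tanh2_0 monom0 expr0n mulN1r add0r sub0r expr0n in intG.
have {intG} : improper_integral (fun t => dtanh2X k.+2 t * monom q t +
    (tanh2 t ^+ k.+2 - tanh2 t ^+ k) * monom_pred q t) (tanh_moment k q).
  have -> : tanh_moment k q = tanh_moment k q - ((k == 0) && (q == 0))%:R +
     - (- (k == 0)%:R * (q == 0)%:R) by case: eqVneq => _; case: eqVneq => _ /=; ring.
  by apply: improper_integral_ext intG => t _; ring.
rewrite andFb subr0 /tanh_moment two_stepSS -/tanh_moment.
case: q dG cvgG => [|q] _ _ intG.
  by rewrite addr0; apply: improper_integral_ext intG => t _; rewrite /= mulr0 addr0.
have := improper_integralD intG (improper_integralZ (2 / k.+1%:R) (IHSk q)).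
rewrite subr0; apply: improper_integral_ext => t _.
have k0 : k.+1%:R != 0 :> R by rewrite pnatr_eq0.
by rewrite /dtanh2X /= !exprS; field.
Unshelve. all: by end_near. Qed.

Lemma tanh_moment_ge0 k q : 0 <= tanh_moment k q.
Proof.
case: k => [|k]; first by rewrite /tanh_moment/= ler0n.
have := integral_dtanh2X_monom k.+1 q; rewrite subr0.
apply: improper_integral_le (improper_integral0 R) => t t0.
by rewrite mulr_ge0 ?monom_ge0 ?dtanh2X_ge0.
Qed.

End Moments.

Section FourthRoot.
Variable R : realType.

(* The exponent 1/4 serves to absorb all powers of logarithms: the bound
   O(n^(1/4)) is preserved by passing from s to the sums of s k / k, and three
   such factors are still o(n). *)
Definition root4 (n : nat) : R := Num.sqrt (Num.sqrt n%:R).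

Lemma root4_ge0 n : 0 <= root4 n. Proof. exact: sqrtr_ge0. Qed.

Lemma root4X n : root4 n ^+ 4 = n%:R.
Proof. by rewrite (exprM _ 2 2) !sqr_sqrtr// sqrtr_ge0. Qed.

Lemma root4_0 : root4 0 = 0. Proof. by rewrite /root4 sqrtr0 sqrtr0. Qed.

Lemma root4_le m n : (m <= n)%N -> root4 m <= root4 n.
Proof. by move=> mn; rewrite !ler_wsqrtr// ler_nat. Qed.

Lemma root4_ge1 n : (0 < n)%N -> 1 <= root4 n.
Proof.
by move=> n0; rewrite -[leLHS]sqrtr1 ler_wsqrtr// -[leLHS]sqrtr1 ler_wsqrtr// ler1n.
Qed.

Lemma root4_gt0 n : (0 < n)%N -> 0 < root4 n.
Proof. by move=> /root4_ge1; exact: lt_le_trans. Qed.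

Lemma root4_diff n : root4 n.+1 / n.+1%:R <= 4 * (root4 n.+1 - root4 n).
Proof.
have s1 := @root4_ge1 n.+1 isT; have s0 := root4_ge0 n.
have ss : root4 n <= root4 n.+1 by exact: root4_le.
have : root4 n.+1 ^+ 4 - root4 n ^+ 4 = 1.
  by rewrite !root4X -natrB// subSnn.
rewrite -(root4X n.+1); move: (root4 n.+1) (root4 n) s1 s0 ss => s r s1 s0 ss.
move=> e; rewrite ler_pdivrMr ?exprn_gt0//; last by lra.
have le4 : 1 <= (s - r) * (4 * s ^+ 3).
  apply: (@le_trans _ _ (s ^+ 4 - r ^+ 4)); first by rewrite e.
  have -> : s ^+ 4 - r ^+ 4 = (s - r) * (s ^+ 3 + s ^+ 2 * r + s * r ^+ 2 + r ^+ 3).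
    by ring.
  apply: ler_wpM2l; first by rewrite subr_ge0.
  have r2 : r ^+ 2 <= s ^+ 2 by rewrite ler_sqr ?nnegrE//; lra.
  have r3 : r ^+ 3 <= s ^+ 3 by apply: lerXn2r; rewrite ?nnegrE//; lra.
  have h1 : s ^+ 2 * r <= s ^+ 3 by rewrite [leRHS]exprSr ler_wpM2l ?sqr_ge0.
  have h2 : s * r ^+ 2 <= s ^+ 3 by rewrite [leRHS]exprS ler_wpM2l//; lra.
  by lra.
have -> : 4 * (s - r) * s ^+ 4 = s * ((s - r) * (4 * s ^+ 3)) by ring.
by rewrite ler_peMr//; lra.
Qed.

Lemma sum_root4_div n : \sum_(b < n.+1) root4 b / b%:R <= 4 * root4 n.
Proof.
elim: n => [|n IH]; first by rewrite big_ord1 root4_0 mul0r mulr0.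
rewrite big_ord_recr /=; apply: le_trans (lerD IH (root4_diff n)) _; lra.
Qed.

Lemma invf_root4_cvg0 : (root4 n)^-1 @[n --> \oo] --> 0.
Proof.
apply/cvgrPdist_le => e e0; near=> n.
have n0 : (0 < n)%N by near: n; exact: nbhs_infty_gt.
rewrite sub0r normrN ger0_norm ?invr_ge0 ?root4_ge0// -[leRHS]invrK.
rewrite lef_pV2 ?posrE ?root4_gt0 ?invr_gt0//.
rewrite -(@ler_pXn2r _ 4) ?nnegrE ?root4_ge0 ?invr_ge0 ?(ltW e0)// root4X.
near: n; exact: nbhs_infty_ger.
Unshelve. all: by end_near. Qed.

End FourthRoot.

Section Chains.
Variable R : realType.

(* [chain j q a] is, up to the sign [(-1)^((a - j)/2)], the coefficient of y^q
   in the sum over a_1 < ... < a_j = a of alternating parity, with a_1 odd, of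
   the products of the 2/(a_i - y). *)
Fixpoint chain (j q a : nat) : R :=
  if j is j'.+1 then
    \sum_(i < q.+1) 2 / a%:R ^+ i.+1 *
      \sum_(b < a | odd (a - b)) (-1) ^+ (a - b)./2 * chain j' (q - i) b
  else ((q == 0) && (a == 0))%:R.

Arguments chain : simpl never.

Definition chain_sum j q a : R :=
  \sum_(b < a | odd (a - b)) (-1) ^+ (a - b)./2 * chain j q b.

Lemma chainS j q a : chain j.+1 q a =
  \sum_(i < q.+1) 2 / a%:R ^+ i.+1 * chain_sum j (q - i) a.
Proof. by []. Qed.

Lemma chain_sum0 j q : chain_sum j q 0 = 0.
Proof. by rewrite /chain_sum big_ord0. Qed.

Lemma chain_sum1 j q : chain_sum j q 1 = chain j q 0.
Proof. by rewrite /chain_sum big_mkcond big_ord1 /= expr0 mul1r. Qed.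

Lemma chain_sumSS j q a : chain_sum j q a.+2 = chain j q a.+1 - chain_sum j q a.
Proof.
rewrite /chain_sum big_mkcond 2!big_ord_recr /= subSnn /= -addn2 addKn /=.
rewrite expr0 mul1r addr0 addrC; congr (_ + _).
rewrite -sumrN [RHS]big_mkcond; apply: eq_bigr => b _ /=.
have -> : (a + 2 - b = (a - b).+2)%N by have := ltn_ord b; lia.
by rewrite /= negbK; case: ifP => // _; rewrite exprS mulN1r mulNr.
Qed.

Lemma chain_rec j q a : a.+1%:R * chain j.+1 q a.+1 =
  (if q is q'.+1 then chain j.+1 q' a.+1 else 0) + 2 * chain_sum j q a.+1.
Proof.
have a0 : a.+1%:R != 0 :> R by rewrite pnatr_eq0.
rewrite chainS big_ord_recl /= expr1 subn0 mulrDr mulrA mulrCA mulfV// mulr1 addrC.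
congr (_ + _); case: q => [|q]; first by rewrite big_ord0 mulr0.
rewrite chainS mulr_sumr; apply: eq_bigr => i _ /=.
rewrite /bump /= add1n subSS mulrA; congr (_ * _).
by rewrite [_ ^+ i.+2]exprS invfM mulrCA [a.+1%:R * _]mulrA mulfV// mul1r.
Qed.

Lemma chain0 j q : chain j.+1 q 0 = 0.
Proof. by rewrite chainS big1// => i _; rewrite chain_sum0 mulr0. Qed.

Lemma chain_poly j q (z : R) n :
  (1 + z ^+ 2) * \sum_(a < n) chain_sum j q a.+1 * z ^+ a =
  \sum_(a < n.+1) chain j q a * z ^+ a -
    (chain_sum j q n.+1 * z ^+ n - chain_sum j q n * z ^+ n.+1).
Proof.
elim: n => [|n IH].
  rewrite big_ord0 big_ord1 chain_sum0 chain_sum1; ring.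
rewrite [in LHS]big_ord_recr [in RHS]big_ord_recr /= mulrDr IH chain_sumSS !exprS; ring.
Qed.

Lemma chain_bound_step j q C : 0 <= C ->
  (forall i a, (i <= q)%N -> `|chain_sum j (q - i) a| <= C * root4 R a) ->
  forall a, `|chain j.+1 q a| <= 2 * q.+1%:R * C * (root4 R a / a%:R).
Proof.
move=> C0 bC [|a]; first by rewrite chain0 normr0 root4_0 mul0r mulr0.
rewrite chainS (le_trans (ler_norm_sum _ _ _))//.
have -> : 2 * q.+1%:R * C * (root4 R a.+1 / a.+1%:R) =
    \sum_(i < q.+1) 2 / a.+1%:R * (C * root4 R a.+1).
  by rewrite sumr_const card_ord -mulr_natr; ring.
apply: ler_sum => i _; rewrite normrM ler_pM//; last first.
  by apply: bC; rewrite -ltnS.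
rewrite ger0_norm ?divr_ge0 ?exprn_ge0// ler_wpM2l//.
by rewrite lef_pV2 ?posrE ?exprn_gt0 ?ltr0n// exprS ler_peMr// exprn_ege1// ler1n.
Qed.

Lemma chain_sum_le j q a : `|chain_sum j q a| <= \sum_(b < a) `|chain j q b|.
Proof.
rewrite /chain_sum big_mkcond (le_trans (ler_norm_sum _ _ _))//.
apply: ler_sum => b _; case: ifP => _; last by rewrite normr0.
by rewrite normrM normrX normrN1 expr1n mul1r.
Qed.

Lemma chain_abs_bound j q : exists2 C, 0 <= C &
  forall a, \sum_(b < a) `|chain j q b| <= C * root4 R a.
Proof.
elim: j q => [|j IH] q.
  exists 1 => // -[|a]; first by rewrite big_ord0 root4_0 mulr0.
  rewrite mul1r big_ord_recl big1 => [|b _]; last by rewrite /chain /= andbF normr0.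
  rewrite addr0 (le_trans _ (root4_ge1 _ _))// /chain /= andbT.
  by case: eqP; rewrite ?normr1 ?normr0.
have /choice[C HC] : forall q', exists C, 0 <= C /\
    forall a, \sum_(b < a) `|chain j q' b| <= C * root4 R a.
  by move=> q'; have [C C0 CP] := IH q'; exists C.
pose K := \sum_(i < q.+1) C i.
have K0 : 0 <= K by apply: sumr_ge0 => i _; have [] := HC i.
have bK i a : (i <= q)%N -> `|chain_sum j (q - i) a| <= K * root4 R a.
  move=> iq; apply: le_trans (chain_sum_le _ _ _) _.
  apply: le_trans (proj2 (HC (q - i)%N) a) _; rewrite ler_wpM2r ?root4_ge0//.
  have qi : (q - i < q.+1)%N by rewrite ltnS leq_subr.
  rewrite /K (bigD1 (Ordinal qi))//= lerDl sumr_ge0// => i' _.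
  by have [] := HC i'.
have bch := chain_bound_step K0 bK.
exists (4 * (2 * q.+1%:R * K)) => [|[|a]]; first by rewrite !mulr_ge0.
  by rewrite big_ord0 root4_0 mulr0.
apply: le_trans (ler_sum _ (fun i _ => bch _)) _.
rewrite -mulr_sumr [4 * _]mulrC -[leRHS]mulrA ler_wpM2l ?mulr_ge0//.
apply: le_trans (sum_root4_div _ _) _.
by rewrite ler_wpM2l// root4_le.
Qed.

Lemma tanh_moment_bound q : exists2 C, 0 <= C &
  forall k, tanh_moment R k.+1 q <= C * root4 R k.+1.
Proof.
elim: q => [|q [C C0 HC]].
  exists 1 => // k; rewrite mul1r (le_trans _ (root4_ge1 _ _))//.
  suff -> : forall k, tanh_moment R k 0 = 1 by [].
  elim/two_step_ind => [//||k' IH _]; last first.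
    by rewrite /tanh_moment two_stepSS addr0.
  by rewrite /tanh_moment/= /zetabar eqxx mulfV.
have b1 := tanh_moment_ge0 R 1 q.+1.
have bS k : tanh_moment R k q.+1 <= (8 * C + tanh_moment R 1 q.+1) * root4 R k.
  elim/two_step_ind: k => [||k IH _].
  - by rewrite root4_0 mulr0 /tanh_moment.
  - rewrite -[leLHS]mulr1 ler_pM// ?root4_ge1//; lra.
  have -> : tanh_moment R k.+2 q.+1 =
    tanh_moment R k q.+1 + 2 / k.+1%:R * tanh_moment R k.+1 q by [].
  have st : 2 / k.+1%:R * tanh_moment R k.+1 q <=
      8 * C * (root4 R k.+1 - root4 R k).
    have := root4_diff R k => d.
    apply: (@le_trans _ _ (2 * C * (root4 R k.+1 / k.+1%:R))).
      have -> : 2 * C * (root4 R k.+1 / k.+1%:R) =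
        2 / k.+1%:R * (C * root4 R k.+1) by ring.
      by rewrite ler_wpM2l.
    have -> : 8 * C * (root4 R k.+1 - root4 R k) =
        2 * C * (4 * (root4 R k.+1 - root4 R k)) by ring.
    by rewrite ler_wpM2l// mulr_ge0.
  have r1 : root4 R k <= root4 R k.+1 by exact: root4_le.
  have r2 : root4 R k.+1 <= root4 R k.+2 by exact: root4_le.
  have h1 : 0 <= tanh_moment R 1 q.+1 * (root4 R k.+1 - root4 R k).
    by rewrite mulr_ge0// subr_ge0.
  have h2 : 0 <= (8 * C + tanh_moment R 1 q.+1) * (root4 R k.+2 - root4 R k.+1).
    by rewrite mulr_ge0 ?subr_ge0// addr_ge0// mulr_ge0.
  by apply: le_trans (lerD IH st) _; lra.
by exists (8 * C + tanh_moment R 1 q.+1) => //; rewrite addr_ge0// mulr_ge0.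
Qed.

End Chains.

Arguments chain : simpl never.

Section Transport.
Variable R : realType.
Implicit Types t : R.
Local Notation X := (@tanh2 R).
Local Notation u := (@expN R).

Lemma cvg_sum_fun (F : set_system R) {FF : Filter F} (T : Type) (s : seq T)
    (f : T -> R -> R) (l : T -> R) :
  (forall i, f i t @[t --> F] --> l i) ->
  \sum_(i <- s) f i t @[t --> F] --> \sum_(i <- s) l i.
Proof.
move=> fl; elim: s => [|x s IH].
  by rewrite big_nil; under eq_fun do rewrite big_nil; exact: cvg_cst.
by rewrite big_cons; under eq_fun do rewrite big_cons; apply: cvgD.
Qed.

Lemma chain_abs_bound_uniform r q : exists2 C, 0 <= C &
  forall j q' a, (j <= r)%N -> (q' <= q)%N ->
    \sum_(b < a) `|chain R j q' b| <= C * root4 R a.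
Proof.
have /choice[C HC] : forall p : nat * nat, exists C, 0 <= C /\
    forall a, \sum_(b < a) `|chain R p.1 p.2 b| <= C * root4 R a.
  by move=> p; have [C C0 CP] := chain_abs_bound R p.1 p.2; exists C.
exists (\sum_(j < r.+1) \sum_(l < q.+1) C (val j, val l)).
  by apply: sumr_ge0 => j _; apply: sumr_ge0 => l _; have [] := HC (val j, val l).
move=> j q' a jr q'q; apply: le_trans (proj2 (HC (j, q')) a) _.
rewrite ler_wpM2r ?root4_ge0//.
have jr' : (j < r.+1)%N by []. have qq' : (q' < q.+1)%N by [].
rewrite (bigD1 (Ordinal jr'))//= (bigD1 (Ordinal qq'))//= -addrA lerDl.
rewrite addr_ge0// sumr_ge0// => [l _|i _]; first by have [] := HC (j, val l).
by apply: sumr_ge0 => l _; have [] := HC (val i, val l).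
Qed.

Variable n : nat.

Definition xpoly i t : R := \sum_(k < n.+1) chain R i 0 k * X t ^+ k.

Definition upoly j q t : R :=
  \sum_(a < n.+1) \sum_(l < q.+1) chain R j (q - l) a * (u t ^+ a * monom l t).

Definition xrem i t : R :=
  chain_sum R i 0 n.+1 * X t ^+ n - chain_sum R i 0 n * X t ^+ n.+1.

Definition urem j q t : R := \sum_(l < q.+1)
  (chain_sum R j (q - l) n.+1 * u t ^+ n - chain_sum R j (q - l) n * u t ^+ n.+1)
    * monom l t.

Lemma xpoly0 t : xpoly 0 t = 1.
Proof.
rewrite /xpoly big_ord_recl big1 => [|k _]; last by rewrite /chain /= mul0r.
by rewrite addr0 /chain /= expr0 mulr1.
Qed.

Lemma upoly0 q t : upoly 0 q t = monom q t.
Proof.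
rewrite /upoly big_ord_recl [Y in _ + Y]big1 ?addr0 => [|a _]; last first.
  by apply: big1 => l _; rewrite /chain /= andbF mul0r.
rewrite big_ord_recr /= big1 => [|l _]; last first.
  by rewrite /chain /= andbT subn_eq0 leqNgt ltn_ord mul0r.
by rewrite add0r subnn /chain /= expr0 !mul1r.
Qed.

Lemma is_derive_xpoly i t :
  is_derive t 1 (xpoly i.+1) (sech t * (xpoly i t - xrem i t)).
Proof.
have := @is_derive1_sum R _ (index_enum 'I_n.+1) xpredT
  (fun (k : 'I_n.+1) x => chain R i.+1 0 k * X x ^+ k) _ t
  (fun k => is_derive1Z _ (is_derive_tanh2X k t)).
move=> d; apply: (is_derive_eq d).
rewrite /xpoly /xrem -chain_poly mulrA sech_tanh2 big_ord_recl chain0 mul0r add0r.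
rewrite mulr_sumr; apply: eq_bigr => k _ /=.
rewrite /bump /= add1n.
have := chain_rec R i 0 k; rewrite add0r => e.
by rewrite !mulrA [chain _ _ _ _ * _]mulrC e; field.
Qed.

Lemma sum_monom_pred (c : nat -> R) q t :
  \sum_(l < q.+1) c (q - l)%N * monom_pred l t =
  \sum_(l < q.+1) (if (q - l)%N is q'.+1 then c q' else 0) * monom l t.
Proof.
rewrite big_ord_recl [RHS]big_ord_recr /= subnn mulr0 add0r mul0r addr0.
apply: eq_bigr => l _ /=; rewrite /bump /= add1n.
by have -> : (q - l)%N = (q - l.+1).+1 by have := ltn_ord l; lia.
Qed.

Lemma is_derive_upoly j q t :
  is_derive t 1 (upoly j.+1 q) (- (sech t * (upoly j q t - urem j q t))).
Proof.
have := @is_derive1_sum R _ (index_enum 'I_n.+1) xpredT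
  (fun (a : 'I_n.+1) x => \sum_(l < q.+1) chain R j.+1 (q - l) a * (u x ^+ a * monom l x))
  _ t (fun a => @is_derive1_sum R _ (index_enum 'I_q.+1) xpredT
   (fun (l : 'I_q.+1) x => chain R j.+1 (q - l) a * (u x ^+ a * monom l x)) _ t
   (fun l => is_derive1Z _ (is_derive_expNX_monom a l t))).
move=> d; apply: (is_derive_eq d).
transitivity (- \sum_(a < n.+1) \sum_(l < q.+1)
    2 * chain_sum R j (q - l) a * u t ^+ a * monom l t).
  rewrite -sumrN; apply: eq_bigr => a _.
  case: (nat_of_ord a) => [|k].
    rewrite !big1 ?oppr0// => l _; last by rewrite chain0 mul0r.
    by rewrite chain_sum0 mulr0 !mul0r.
  transitivity (u t ^+ k.+1 * (\sum_(l < q.+1) chain R j.+1 (q - l) k.+1 * monom_pred l t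
     - \sum_(l < q.+1) k.+1%:R * chain R j.+1 (q - l) k.+1 * monom l t)).
    rewrite -sumrB mulr_sumr; apply: eq_bigr => l _; ring.
  rewrite (sum_monom_pred (fun q' => chain R j.+1 q' k.+1)) -sumrB mulr_sumr -sumrN.
  by apply: eq_bigr => l _; rewrite chain_rec; case: (q - l)%N => [|q'] /=; ring.
congr (- _); rewrite exchange_big /= /upoly [Y in _ * (Y - _)]exchange_big /=.
rewrite /urem -sumrB mulr_sumr.
apply: eq_bigr => l _.
rewrite -mulr_suml; under [Y in _ = _ * (Y - _)]eq_bigr do rewrite mulrA.
rewrite -mulr_suml -mulrBl -chain_poly [RHS]mulrA [sech t * _]mulrA sech_expN; congr (_ * _).
rewrite big_ord_recl chain_sum0 mulr0 mul0r add0r mulr_sumr.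
by apply: eq_bigr => a _; rewrite /= /bump /= add1n exprS; ring.
Qed.

Definition transport_err r q t : R := sech t *
  \sum_(i < r.+1) (xpoly i t * urem (r - i) q t - xrem i t * upoly (r - i) q t).

Lemma is_derive_transport r q t :
  is_derive t 1 (fun x => \sum_(i < r.+1) xpoly i x * upoly (r.+1 - i) q x)
    (transport_err r q t - sech t * (xpoly r t - xrem r t) * monom q t).
Proof.
pose dx i := if i is i'.+1 then sech t * (xpoly i' t - xrem i' t) else 0.
have dxE i : is_derive t 1 (xpoly i) (dx i).
  case: i => [|i]; last exact: is_derive_xpoly.
  have -> : xpoly 0 = cst 1 by apply/funext => x; rewrite xpoly0.
  exact: is_derive_cst.
have := @is_derive1_sum R _ (index_enum 'I_r.+1) xpredT
  (fun (i : 'I_r.+1) x => xpoly i x * upoly (r - i).+1 q x) _ t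
  (fun i => is_derive1M (dxE i) (is_derive_upoly (r - i) q t)).
have -> : (fun x => \sum_(i < r.+1) xpoly i x * upoly (r - i).+1 q x) =
          (fun x => \sum_(i < r.+1) xpoly i x * upoly (r.+1 - i) q x).
  by apply/funext => x; apply: eq_bigr => i _; rewrite subSn// -ltnS.
move=> d; apply: (is_derive_eq d).
rewrite big_split /= big_ord_recl /= mul0r add0r.
under eq_bigr => i _ do rewrite /bump /= add1n -subSn ?subSS ?ltn_ord//.
rewrite /transport_err [in RHS]big_ord_recr big_ord_recr /= subnn upoly0.
rewrite addrA -big_split /=.
have -> : \sum_(i < r) (sech t * (xpoly i t - xrem i t) * upoly (r - i) q t +
    xpoly i t * - (sech t * (upoly (r - i) q t - urem (r - i) q t))) =
  \sum_(i < r) sech t * (xpoly i t * urem (r - i) q t - xrem i t * upoly (r - i) q t).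
  by apply: eq_bigr => i _; ring.
rewrite -mulr_sumr; ring.
Qed.

Lemma xpoly_at0 i : xpoly i 0 = (i == 0)%:R.
Proof.
rewrite /xpoly big_ord_recl big1 => [|k _]; last by rewrite tanh2_0 exprS mul0r mulr0.
rewrite addr0 expr0 mulr1 /=; case: i => [|i]; last by rewrite chain0.
by rewrite /chain.
Qed.

Lemma upoly_at0 j q : upoly j q 0 = \sum_(a < n.+1) chain R j q a.
Proof.
apply: eq_bigr => a _; rewrite big_ord_recl big1 => [|l _]; last first.
  by rewrite monom0 /= !mulr0.
by rewrite addr0 monom0 expN0 expr1n /= subn0 !mulr1.
Qed.

Lemma upoly_cvg0 j q : upoly j.+1 q t @[t --> +oo] --> (0 : R).
Proof.
have -> : (0 : R) = \sum_(a < n.+1) \sum_(l < q.+1) 0.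
  by rewrite big1// => a _; rewrite big1.
apply: cvg_sum_fun => a; apply: cvg_sum_fun => l.
case: (nat_of_ord a) => [|k].
  rewrite chain0; under eq_fun do rewrite mul0r; exact: cvg_cst.
rewrite -(mulr0 (chain R j.+1 (q - l) k.+1)).
by apply: cvgM (@expNX_monom_cvg0 R k l); exact: cvg_cst.
Qed.

Lemma xpoly_cvg i : xpoly i t @[t --> +oo] --> \sum_(k < n.+1) chain R i 0 k.
Proof.
apply: cvg_sum_fun => k; rewrite -[Y in _ --> Y]mulr1 -[Y in _ * Y](expr1n _ k).
apply: cvgM; first exact: cvg_cst.
elim: (nat_of_ord k) => [|k' IH]; first by under eq_fun do rewrite expr0; exact: cvg_cst.
rewrite exprS; under eq_fun do rewrite exprS.
by apply: cvgM => //; exact: tanh2_cvg1.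
Qed.

Lemma integral_transport_err r q : improper_integral (transport_err r q)
  (\sum_(k < n.+1) chain R r.+1 0 k * tanh_moment R k q -
   \sum_(a < n.+1) chain R r.+1 q a).
Proof.
have cvgH : \sum_(i < r.+1) xpoly i t * upoly (r.+1 - i) q t @[t --> +oo] --> (0 : R).
  have := @cvg_sum_fun +oo%R _ _ (index_enum 'I_r.+1)
    (fun i t => xpoly i t * upoly (r.+1 - i) q t)
    (fun i => (\sum_(k < n.+1) chain R i 0 k) * 0).
  rewrite big1 => [|i _]; last by rewrite mulr0.
  apply=> i; apply: cvgM; first exact: xpoly_cvg.
  have ir : (i <= r)%N by rewrite -ltnS.
  by rewrite subSn//; exact: upoly_cvg0.
have intH := improper_integral_antiderivative
  (fun t _ => is_derive_transport r q t) cvgH.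
have intx : improper_integral
    (fun t => \sum_(k < n.+1) chain R r.+1 0 k * (dtanh2X k t * monom q t))
    (\sum_(k < n.+1) chain R r.+1 0 k * tanh_moment R k q).
  have -> : \sum_(k < n.+1) chain R r.+1 0 k * tanh_moment R k q =
     \sum_(k < n.+1) chain R r.+1 0 k * (tanh_moment R k q - ((k == 0%N :> nat) && (q == 0%N))%:R).
    apply: eq_bigr => k _; case: (nat_of_ord k) => [|k']; last by rewrite subr0.
    by rewrite chain0 !mul0r.
  by apply: improper_integral_sum => k _; apply: improper_integralZ;
     exact: integral_dtanh2X_monom.
have := improper_integralD intH intx.
have -> : \sum_(i < r.+1) xpoly i 0 * upoly (r.+1 - i) q 0 =
    \sum_(a < n.+1) chain R r.+1 q a.
  rewrite big_ord_recl big1 => [|i _]; last by rewrite xpoly_at0 /= mul0r.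
  by rewrite xpoly_at0 mul1r addr0 subn0 upoly_at0.
rewrite sub0r addrC; apply: improper_integral_ext => t t0.
under eq_bigr do rewrite mulrA.
rewrite -mulr_suml.
have := @is_derive1_sum R _ (index_enum 'I_n.+1) xpredT
  (fun (k : 'I_n.+1) x => chain R r.+1 0 k * X x ^+ k) _ t
  (fun k => is_derive1Z _ (is_derive_tanh2X k t)) => d.
have d' := is_derive_xpoly r t.
have -> : \sum_(k < n.+1) chain R r.+1 0 k * dtanh2X k t =
    sech t * (xpoly r t - xrem r t).
  by rewrite -(@derive_val _ _ _ _ _ _ _ d') -(@derive_val _ _ _ _ _ _ _ d).
by rewrite subrK.
Qed.

End Transport.

Section TransportLimit.
Variable R : realType.
Implicit Types t : R.

Lemma sech_tanh2X_le n t : 0 <= t ->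
  sech t * tanh2 t ^+ n <= 2 / n.+1%:R * dtanh2X n.+1 t.
Proof.
move=> t0; have X0 := tanh2_ge0 t0; have s0 := sech_ge0 t.
have n0 : n.+1%:R != 0 :> R by rewrite pnatr_eq0.
have -> : 2 / n.+1%:R * dtanh2X n.+1 t =
    tanh2 t ^+ n * (1 - tanh2 t ^+ 2) by rewrite /dtanh2X /=; field.
rewrite -sech_tanh2 mulrC ler_wpM2l ?exprn_ge0// ler_peMr//.
by rewrite lerDl sqr_ge0.
Qed.

Lemma transport_err_le n r q C t : 0 <= C -> 0 <= t ->
  (forall j q' a, (j <= r)%N -> (q' <= q)%N ->
    \sum_(b < a) `|chain R j q' b| <= C * root4 R a) ->
  `|transport_err n r q t| <= \sum_(l < q.+1)
     2 * (C * root4 R n.+1) ^+ 2 * r.+1%:R *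
     (2 * (expN t ^+ n.+1 * monom l t) +
      2 / n.+1%:R * (dtanh2X n.+1 t * monom l t)).
Proof.
move=> C0 t0 bC; set P := C * root4 R n.+1.
have P0 : 0 <= P by rewrite mulr_ge0 ?root4_ge0.
have X0 := tanh2_ge0 t0; have X1 := tanh2_le1 t.
have u0 := ltW (expN_gt0 t); have u1 := expN_le1 t0.
have m0 l : 0 <= monom l t by exact: monom_ge0.
pose M := \sum_(l < q.+1) monom l t.
have M0 : 0 <= M by apply: sumr_ge0.
have hs j q' : (j <= r)%N -> (q' <= q)%N ->
    `|chain_sum R j q' n.+1| <= P /\ `|chain_sum R j q' n| <= P.
  move=> jr qq; split; apply: le_trans (chain_sum_le _ _ _ _) _; first exact: bC.
  apply: le_trans (bC _ _ _ jr qq) _.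
  by rewrite ler_wpM2l// root4_le.
have hx i : (i <= r)%N -> `|xpoly n i t| <= P.
  move=> ir; apply: le_trans (bC i 0 n.+1 ir isT).
  apply: le_trans (ler_norm_sum _ _ _) _; apply: ler_sum => k _.
  by rewrite normrM ler_piMr// ger0_norm ?exprn_ge0// exprn_ile1.
have hu j : (j <= r)%N -> `|upoly n j q t| <= P * M.
  move=> jr; rewrite /upoly exchange_big /= mulr_sumr.
  apply: le_trans (ler_norm_sum _ _ _) _; apply: ler_sum => l _.
  under eq_bigr do rewrite mulrA.
  rewrite -mulr_suml normrM (ger0_norm (m0 _)) ler_wpM2r//.
  apply: le_trans (bC j (q - l)%N n.+1 jr (leq_subr _ _)).
  apply: le_trans (ler_norm_sum _ _ _) _; apply: ler_sum => k _.
  by rewrite normrM ler_piMr// ger0_norm ?exprn_ge0// exprn_ile1.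
have rem_le (a b z : R) : `|a| <= P -> `|b| <= P -> 0 <= z -> z <= 1 ->
    `|a * z ^+ n - b * z ^+ n.+1| <= 2 * P * z ^+ n.
  move=> aP bP z0 z1; have zn : 0 <= z ^+ n by rewrite exprn_ge0.
  rewrite exprS mulrA -mulrBl normrM (ger0_norm zn) ler_wpM2r//.
  apply: le_trans (ler_normB _ _) _; rewrite normrM (ger0_norm z0).
  have : `|b| * z <= `|b| by rewrite ler_piMr.
  by lra.
have hxr i : (i <= r)%N -> `|xrem n i t| <= 2 * P * tanh2 t ^+ n.
  by move=> ir; have [? ?] := hs i 0 ir isT; exact: rem_le.
have hur j : (j <= r)%N -> `|urem n j q t| <= 2 * P * expN t ^+ n * M.
  move=> jr; rewrite /urem /M mulr_sumr.
  apply: le_trans (ler_norm_sum _ _ _) _; apply: ler_sum => l _.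
  rewrite normrM (ger0_norm (m0 _)) ler_wpM2r//.
  by have [? ?] := hs j (q - l)%N jr (leq_subr _ _); exact: rem_le.
have s0 := sech_ge0 t.
apply: (@le_trans _ _ (\sum_(l < q.+1) 2 * P ^+ 2 * r.+1%:R *
   ((sech t * expN t ^+ n + sech t * tanh2 t ^+ n) * monom l t))).
  rewrite -mulr_sumr -mulr_sumr -/M /transport_err normrM (ger0_norm s0).
  have -> : 2 * P ^+ 2 * r.+1%:R *
      ((sech t * expN t ^+ n + sech t * tanh2 t ^+ n) * M) =
    sech t * \sum_(i < r.+1) (P * (2 * P * expN t ^+ n * M)
       + 2 * P * tanh2 t ^+ n * (P * M)).
    by rewrite sumr_const card_ord -mulr_natr; ring.
  rewrite ler_wpM2l// (le_trans (ler_norm_sum _ _ _))//; apply: ler_sum => i _.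
  have ir : (i <= r)%N by rewrite -ltnS.
  apply: le_trans (ler_normB _ _) _; rewrite !normrM lerD// ler_pM ?hx ?hxr//.
    by apply: hur; exact: leq_subr.
  by apply: hu; exact: leq_subr.
apply: ler_sum => l _; rewrite ler_wpM2l//.
  by apply: mulr_ge0 => //; apply: mulr_ge0 => //; exact: sqr_ge0.
rewrite [2 * (_ * monom l t)]mulrA [2 / _ * (_ * monom l t)]mulrA -[leRHS]mulrDl.
rewrite ler_wpM2r// lerD ?sech_tanh2X_le//.
by rewrite exprS mulrA ler_wpM2r ?exprn_ge0// sech_le.
Qed.

Lemma transport_bound r q : exists K, forall n,
  `|\sum_(k < n.+1) chain R r.+1 0 k * tanh_moment R k q -
    \sum_(a < n.+1) chain R r.+1 q a| <= K * (root4 R n.+1)^-1.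
Proof.
have [C C0 bC] := chain_abs_bound_uniform R r q.
have /choice[B HB] : forall l, exists B, 0 <= B /\
    forall k, tanh_moment R k.+1 l <= B * root4 R k.+1.
  by move=> l; have [B B0 BP] := tanh_moment_bound R l; exists B.
exists (\sum_(l < q.+1) 2 * C ^+ 2 * r.+1%:R * (2 * (1 + B l))) => n.
pose c : R := 2 * (C * root4 R n.+1) ^+ 2 * r.+1%:R.
have intb : improper_integral (fun t => \sum_(l < q.+1) c *
     (2 * (expN t ^+ n.+1 * monom l t) +
      2 / n.+1%:R * (dtanh2X n.+1 t * monom l t)))
   (\sum_(l < q.+1) c * (2 * (n.+1%:R ^+ l.+1)^-1 +
      2 / n.+1%:R * (tanh_moment R n.+1 l - 0))).
  apply: improper_integral_sum => l _; apply: improper_integralZ.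
  apply: improper_integralD; apply: improper_integralZ.
    exact: integral_expNX_monom.
  exact: integral_dtanh2X_monom.
have intE := integral_transport_err R n r q.
apply: le_trans (improper_integral_norm_le _ intE intb) _ => [t t0|].
  exact: transport_err_le.
rewrite mulr_suml; apply: ler_sum => l _; rewrite subr0.
have p1 : 1 <= root4 R n.+1 by exact: root4_ge1.
have [B0 /(_ n) Bn] := HB l.
have inv_le : (n.+1%:R ^+ l.+1)^-1 <= n.+1%:R^-1 * root4 R n.+1.
  apply: (@le_trans _ _ n.+1%:R^-1); last by rewrite ler_peMr.
  by rewrite lef_pV2 ?posrE ?exprn_gt0 ?ltr0n// exprS ler_peMr// exprn_ege1// ler1n.
apply: (@le_trans _ _ (2 * (C * root4 R n.+1) ^+ 2 * r.+1%:R *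
   (2 * (n.+1%:R^-1 * root4 R n.+1) + 2 / n.+1%:R * (B l * root4 R n.+1)))).
  rewrite ler_wpM2l//; last by rewrite lerD// ler_wpM2l.
  by apply: mulr_ge0 => //; apply: mulr_ge0 => //; exact: sqr_ge0.
have r0 : root4 R n.+1 != 0 by rewrite gt_eqF// root4_gt0.
rewrite -(root4X R n.+1) le_eqVlt; apply/orP; left; apply/eqP.
by field.
Qed.

Lemma transport_cvg0 r q :
  \sum_(k < n.+1) chain R r.+1 0 k * tanh_moment R k q -
    \sum_(a < n.+1) chain R r.+1 q a @[n --> \oo] --> (0 : R).
Proof.
have [K HK] := transport_bound r q.
have cvgK : K * (root4 R n.+1)^-1 @[n --> \oo] --> (K * 0 : R).
  apply: cvgM; first exact: cvg_cst.
  have := @invf_root4_cvg0 R; rewrite -(cvg_shiftS (fun n => (root4 R n)^-1)).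
  exact.
rewrite mulr0 in cvgK.
have cvgKN : - (K * (root4 R n.+1)^-1) @[n --> \oo] --> (0 : R).
  by rewrite -oppr0; apply: cvgN.
apply: (squeeze_cvgr _ cvgKN cvgK); near=> n.
by rewrite -ler_norml.
Unshelve. all: by end_near. Qed.

End TransportLimit.

Section Links.
Variable R : realType.

Lemma chain_parity j q a : odd (a + j) -> chain R j q a = 0.
Proof.
elim: j q a => [|j IH] q a.
  by rewrite addn0 /chain; case: a => // a _; rewrite andbF.
rewrite addnS /= => paj; rewrite chainS big1// => i _.
rewrite /chain_sum big1 ?mulr0// => b pab; rewrite IH ?mulr0//.
by have := ltn_ord b; move: paj pab; lia.
Qed.

Definition alt_sum := two_step (fun=> 0 : R) (fun i => (i == 0)%:R).

Lemma alt_sumSS k i : alt_sum k.+2 i = alt_sum k i +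
  (if i is i'.+1 then 2 / k.+1%:R * alt_sum k.+1 i' else 0).
Proof. by []. Qed.

Lemma alt_sum_parity k i : ~~ odd (k + i) -> alt_sum k i = 0.
Proof.
elim/two_step_ind: k i => [//|[]//|k IH IHS i pki].
rewrite alt_sumSS IH ?add0r; last by move: pki; lia.
by case: i pki => // i pki; rewrite IHS ?mulr0//; move: pki; lia.
Qed.

Lemma alt_sum_odd0 n : alt_sum (2 * n).+1 0 = 1.
Proof. by elim: n => [//|n IH]; rewrite mulnS add2n alt_sumSS addr0. Qed.

Lemma alt_sum_ta l n : (0 < l)%N ->
  alt_sum (2 * n + ~~ odd l) l = 2 ^+ l * \sum_(1 <= m < n.+1) ta R l m.
Proof.
case: l => // l _; elim: l n => [|l IH] n.
  rewrite addn0; elim: n => [|n IHn]; first by rewrite big_geq// mulr0.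
  rewrite mulnS add2n alt_sumSS IHn alt_sum_odd0 [in RHS]big_nat_recr//= mulrDr.
  by rewrite expr1 !mulr1 mulnS add2n subn1.
elim: n => [|n IHn].
  by rewrite big_geq// mulr0 muln0 add0n; case: (odd _).
rewrite mulnS -addnA add2n alt_sumSS IHn [in RHS]big_nat_recr//= mulrDr.
congr (_ + _); have := IH (n + ~~ odd l)%N; rewrite /= !negbK.
case ol: (odd l) => /=.
  rewrite !addn0 addn1 => ->.
  by rewrite mulnS add2n subn1 [in RHS]exprS; ring.
rewrite addn0 !addn1 mulnS add2n => ->.
by rewrite [in RHS]exprS; ring.
Qed.

Lemma Tones_alt_sum n a : (0 < a)%N -> Tones R n a = alt_sum (2 * n) (2 * a - 1).
Proof.
move=> a0; have := @alt_sum_ta (2 * a - 1) n; rewrite /Tones => <-; last by lia.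
have -> : odd (2 * a - 1) by lia.
by rewrite addn0.
Qed.

Lemma chain_sum_alt_sum k i : odd (k + i) ->
  chain_sum R i 0 k = (-1) ^+ (k./2 + uphalf i) * alt_sum k i.
Proof.
elim/two_step_ind: k i => [i _|i|k IH IHS i pki].
- by rewrite chain_sum0 mulr0.
- rewrite chain_sum1; case: i => [_|i _]; last by rewrite chain0 mulr0.
  by rewrite /chain /= expr0 mul1r.
rewrite chain_sumSS alt_sumSS IH; last by move: pki; lia.
case: i pki => [|i] pki.
  by rewrite /chain /= addr0 exprS; ring.
have k0 : k.+1%:R != 0 :> R by rewrite pnatr_eq0.
have -> : chain R i.+1 0 k.+1 = 2 / k.+1%:R * chain_sum R i 0 k.+1.
  by apply: (mulfI k0); rewrite chain_rec add0r; field.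
rewrite IHS; last by move: pki; lia.
have -> : (-1) ^+ ((k.+1)./2 + uphalf i) = (-1) ^+ ((k.+2)./2 + uphalf i.+1) :> R.
  rewrite -signr_odd -[RHS]signr_odd; congr (_ ^+ nat_of_bool _).
  by move: pki; lia.
by rewrite /= exprS; ring.
Qed.

Lemma chain_even_Tones m n : (0 < m)%N ->
  chain R (2 * m) 0 (2 * n.+1) = (-1) ^+ (n.+1 + m) * (Tones R n.+1 m / n.+1%:R).
Proof.
move=> m0; have -> : (2 * m = (2 * m - 1).+1)%N by lia.
have k0 : (2 * n).+2%:R != 0 :> R by rewrite pnatr_eq0.
apply: (mulfI k0); rewrite mulnS add2n chain_rec add0r chain_sum_alt_sum; last by lia.
rewrite Tones_alt_sum// mulnS add2n.
have -> : ((2 * n).+2)./2 = n.+1 by lia.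
have -> : uphalf (2 * m - 1) = m by rewrite uphalfE; lia.
have n0 : n.+1%:R != 0 :> R by rewrite pnatr_eq0.
have -> : (2 * n).+2%:R = 2 * n.+1%:R :> R by rewrite -natrM mulnS.
by field.
Qed.

Lemma tanh_momentSS k q : tanh_moment R k.+2 q = tanh_moment R k q +
  (if q is q'.+1 then 2 / k.+1%:R * tanh_moment R k.+1 q' else 0).
Proof. by []. Qed.

Lemma tanh_moment_alt_sum k q : odd (k + q) -> tanh_moment R k q =
  \sum_(i < q.+1) 2 * zetabar R (q - i) * alt_sum k i.
Proof.
elim/two_step_ind: k q => [q|q _|k IH IHS q pkq].
- rewrite add0n => oq; rewrite big1 => [|i _]; last by rewrite mulr0.
  by rewrite /tanh_moment /=; case: q oq.
- rewrite big_ord_recl big1 => [|i _]; last by rewrite mulr0.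
  by rewrite addr0 subn0 mulr1.
rewrite tanh_momentSS IH; last by move: pkq; lia.
case: q pkq => [|q] pkq; first by rewrite addr0 !big_ord1 alt_sumSS addr0.
rewrite IHS; last by move: pkq; lia.
under [RHS]eq_bigr do rewrite alt_sumSS mulrDr.
rewrite big_split /=; congr (_ + _).
rewrite [RHS]big_ord_recl mulr0 add0r mulr_sumr; apply: eq_bigr => i _ /=.
by rewrite /bump /= add1n subSS; ring.
Qed.

Lemma sum_ord_double (f : nat -> R) n :
  \sum_(i < (2 * n)%N) f i = \sum_(1 <= i < n.+1) (f (2 * i - 2)%N + f (2 * i - 1)%N).
Proof.
elim: n => [|n IH]; first by rewrite big_ord0 big_geq.
rewrite mulnS add2n !big_ord_recr /= IH [in RHS]big_nat_recr//= mulnS add2n.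
by rewrite subn1 subn2 addrA.
Qed.

Lemma tanh_moment_Tones n j : (0 < j)%N -> tanh_moment R (2 * n) (2 * j - 1) =
  \sum_(1 <= i < j.+1) 2 * zetabar R (2 * j - 2 * i) * Tones R n i.
Proof.
move=> j0; rewrite tanh_moment_alt_sum; last by lia.
have -> : ((2 * j - 1).+1 = 2 * j)%N by lia.
rewrite (sum_ord_double
  (fun i => 2 * zetabar R (2 * j - 1 - i) * alt_sum (2 * n) i)).
apply: eq_big_nat => i /andP[i1 ij].
rewrite alt_sum_parity; last by lia.
rewrite mulr0 add0r Tones_alt_sum//.
by have -> : (2 * j - 1 - (2 * i - 1) = 2 * j - 2 * i)%N by lia.
Qed.

End Links.

Section Inversion.
Variable R : realType.

Lemma sum_tuple_cons (K n : nat) (P : pred (seq nat)) (F : seq nat -> R) :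
  \sum_(t : n.+1.-tuple 'I_K | P (map val t)) F (map val t) =
  \sum_(x < K) \sum_(t : n.-tuple 'I_K | P (val x :: map val t))
    F (val x :: map val t).
Proof.
rewrite pair_big_dep /=.
rewrite (reindex (fun xt : 'I_K * n.-tuple 'I_K => [tuple of xt.1 :: xt.2])) //=.
exists (fun t => (thead t, [tuple of behead t])) => [[x t] _|t _] /=.
  by congr (_, _); exact: val_inj.
by rewrite -tuple_eta.
Qed.

Definition chain_pred (k j p : nat) (s : seq nat) :=
  [&& nth 0%N s 0 == j, nth 0%N s k == p & sorted ltn s].

Definition chain_prod (k : nat) (s : seq nat) : R :=
  \prod_(1 <= l < k.+1) zetabar R (2 * nth 0%N s l - 2 * nth 0%N s l.-1).

Definition Zlen (k j p : nat) : R :=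
  \sum_(s : k.+1.-tuple 'I_p.+1 | chain_pred k j p (map val s))
    chain_prod k (map val s).

Lemma Zlen0 j p : (j <= p)%N -> Zlen 0 j p = (j == p)%:R.
Proof.
move=> jp; rewrite /Zlen (sum_tuple_cons _ _ (chain_pred 0 j p) (chain_prod 0)).
have -> : (j == p)%:R = \sum_(x < p.+1) (if (val x == j) && (val x == p) then 1 else 0) :> R.
  have jp' : (j < p.+1)%N by [].
  rewrite (bigD1 (Ordinal jp'))//= eqxx big1 ?addr0.
    by case: eqP.
  by move=> x /eqP xj; case: eqP => //= e; case: xj; apply: val_inj.
apply: eq_bigr => x _; rewrite big_mkcond (big_pred1 [tuple]) /=; last first.
  by move=> t; rewrite /= (tuple0 t); exact/esym/eqP.
by rewrite /chain_pred /chain_prod /= big_geq// andbT.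
Qed.

Lemma Zlen_rec k j p : (j <= p)%N -> Zlen k.+1 j p =
  \sum_(j.+1 <= i < p.+1) zetabar R (2 * i - 2 * j) * Zlen k i p.
Proof.
move=> jp; rewrite /Zlen (sum_tuple_cons _ _ (chain_pred k.+1 j p) (chain_prod k.+1)).
have jp' : (j < p.+1)%N by [].
rewrite (bigD1 (Ordinal jp'))//= [X in _ + X]big1 ?addr0; last first.
  move=> x /eqP xj; apply: big_pred0 => t; rewrite /chain_pred /=.
  by case: eqP => //= e; case: xj; apply: val_inj.
rewrite big_geq_mkord /=.
rewrite (partition_big (fun t : k.+1.-tuple 'I_p.+1 => thead t)
  (fun i : 'I_p.+1 => (j < i)%N)) /=; last first.
  by move=> t; case/tupleP: t => x t; rewrite theadE /chain_pred /= => /and4P[].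
apply: eq_bigr => i ji; rewrite mulr_sumr; apply: eq_big => t.
  case/tupleP: t => x t; rewrite theadE /chain_pred /= eqxx /= -val_eqE /=.
  by case: (eqVneq (val x) (val i)) => [->|]; rewrite ?andbF// ji andbT.
case/tupleP: t => x t; rewrite theadE => /andP[_ /eqP <-].
rewrite /chain_prod big_nat_recl//=; congr (_ * _).
by apply: eq_big_nat => -[|l].
Qed.

Lemma Zlen_vanish k j p : (j <= p)%N -> (p - j < k)%N -> Zlen k j p = 0.
Proof.
elim: k j => [//|k IH] j jp pjk; rewrite Zlen_rec// big_nat big1// => i /andP[ji ip].
by rewrite IH ?mulr0//; lia.
Qed.

Lemma Z_Zlen n j p : (j <= p)%N -> (p - j <= n)%N ->
  Z R j p = \sum_(0 <= k < n.+1) (-2) ^+ k * Zlen k j p.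
Proof.
move=> jp pjn; rewrite big_ltn// expr0 mul1r Zlen0// /Z; case: eqVneq => [->|jp'].
  rewrite big_nat big1 ?addr0// => k /andP[k0 kn].
  by rewrite Zlen_vanish ?mulr0// subnn.
rewrite add0r [RHS](big_cat_nat (n := (p - j).+1)) //=.
rewrite [X in _ = _ + X]big_nat [X in _ = _ + X]big1 ?addr0// => k /andP[k0 kn].
by rewrite Zlen_vanish ?mulr0.
Qed.

Lemma Z_inversion j p : (j <= p)%N ->
  \sum_(j <= i < p.+1) 2 * zetabar R (2 * i - 2 * j) * Z R i p = (j == p)%:R.
Proof.
move=> jp; rewrite big_ltn// subnn {1}/zetabar eqxx mulfV// mul1r.
case: (eqVneq j p) => [->|jp']; first by rewrite big_geq// addr0 /Z eqxx.
rewrite (@Z_Zlen p.+1)//; last by lia.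
rewrite [X in X + _]big_nat_recl// Zlen0// (negbTE jp') mulr0 add0r.
under [X in X + _]eq_bigr do rewrite Zlen_rec// exprS -mulrA mulr_sumr mulr_sumr.
rewrite exchange_big_nat /= -big_split /= big_nat big1// => i /andP[ji ip].
rewrite (@Z_Zlen p)//; last by lia.
rewrite -!mulrA !mulr_sumr -big_split /= big1// => k _; ring.
Qed.

Lemma Tones_tanh_moment n p : (0 < p)%N ->
  Tones R n p = \sum_(1 <= j < p.+1) tanh_moment R (2 * n) (2 * j - 1) * Z R j p.
Proof.
move=> p0.
transitivity (\sum_(1 <= j < p.+1) \sum_(1 <= i < p.+1 | (i <= j)%N)
    2 * zetabar R (2 * j - 2 * i) * Tones R n i * Z R j p); last first.
  apply: eq_big_nat => j /andP[j1 jp]; rewrite tanh_moment_Tones// mulr_suml.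
  by rewrite [RHS](big_nat_widen _ _ p.+1)//.
rewrite (exchange_big_dep xpredT)//=.
transitivity (\sum_(1 <= i < p.+1) (i == p)%:R * Tones R n i).
  rewrite big_nat_recr//= eqxx mul1r big_nat big1 ?add0r// => i /andP[_ ip].
  by rewrite (ltn_eqF ip) mul0r.
apply: eq_big_nat => i /andP[i1 ip].
rewrite -Z_inversion// mulr_suml (big_nat_widenl _ 1)//.
by apply: eq_bigr => j _; ring.
Qed.

End Inversion.

Section AlternatingSeries.
Variable R : realType.

Lemma root4_div_le n : root4 R n.+1 / n.+1%:R <= (root4 R n.+1)^-1.
Proof.
have r1 : 1 <= root4 R n.+1 by exact: root4_ge1.
have r0 : 0 < root4 R n.+1 by exact: root4_gt0.
rewrite -(root4X R n.+1) ler_pdivrMr ?exprn_gt0//.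
rewrite (exprS _ 3) mulrA mulVf ?gt_eqF// mul1r exprS ler_peMr ?(ltW r0)//.
by rewrite exprn_ege1.
Qed.

Lemma sum_root4_div_sqr n :
  \sum_(1 <= m < n.+2) root4 R m / m%:R ^+ 2 <= 5 - 4 * (root4 R n.+1)^-1.
Proof.
elim: n => [|n IH].
  rewrite big_nat1 expr1n divr1 /root4 sqrtr1 sqrtr1 invr1; lra.
rewrite big_nat_recr//=.
have r1 : 0 < root4 R n.+1 by exact: root4_gt0.
have r2 : 0 < root4 R n.+2 by exact: root4_gt0.
have ge1 : 1 <= root4 R n.+2 by exact: root4_ge1.
have mono : root4 R n.+1 <= root4 R n.+2 by exact: root4_le.
have inv_diff : (root4 R n.+1)^-1 - (root4 R n.+2)^-1 =
    (root4 R n.+2 - root4 R n.+1) / (root4 R n.+1 * root4 R n.+2).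
  by field; rewrite !gt_eqF.
have le_diff : root4 R n.+2 / n.+2%:R ^+ 2 <=
    4 * ((root4 R n.+1)^-1 - (root4 R n.+2)^-1).
  rewrite inv_diff mulrA ler_pdivlMr ?mulr_gt0//.
  apply: le_trans (root4_diff R n.+1).
  have le_N : root4 R n.+1 * root4 R n.+2 <= n.+2%:R.
    apply: (@le_trans _ _ (root4 R n.+2 ^+ 2)).
      by rewrite expr2 ler_wpM2r// ltW.
    by rewrite -(root4X R n.+2) (exprM _ 2 2) [leRHS]expr2 ler_peMr ?sqr_ge0// exprn_ege1.
  have -> : root4 R n.+2 / n.+2%:R = root4 R n.+2 / n.+2%:R ^+ 2 * n.+2%:R.
    by field; rewrite gt_eqF// -natr1 ltr_wpDl.
  by rewrite ler_wpM2l// divr_ge0 ?root4_ge0// sqr_ge0.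
by apply: le_trans (lerD IH le_diff) _; lra.
Qed.

Lemma alternating_series_cvg (a : nat -> R) (C D : R) : 0 <= C ->
  (forall m, 0 <= a m.+1 <= D * (root4 R m.+1 / m.+1%:R)) ->
  (forall m, `|a m.+1 - a m.+2| <= C * (root4 R m.+1 / m.+1%:R ^+ 2)) ->
  cvgn (fun N => \sum_(1 <= m < N.+1) (-1) ^+ m * a m).
Proof.
move=> C0 aD aC.
have D0 : 0 <= D.
  have /andP[a0 a1] := aD 0%N; have := le_trans a0 a1.
  by rewrite divr1 /root4 !sqrtr1 mulr1.
pose d k := (-1) ^+ k.+1 * (a k.+1 - a k.+2).
have norm_d k : `|d k| <= C * (root4 R k.+1 / k.+1%:R ^+ 2).
  by rewrite /d normrM normrX normrN1 expr1n mul1r.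
have cvg_d : cvgn (series d).
  apply: normed_cvg; apply: nondecreasing_is_cvgn.
    by apply: nondecreasing_series => n _ _ /=.
  exists (C * 5) => _ [n _ <-]; rewrite /series /=.
  apply: le_trans (ler_sum_nat _) _ => [k _|]; first exact: norm_d.
  rewrite -mulr_sumr ler_wpM2l//.
  have -> : \sum_(0 <= k < n) root4 R k.+1 / k.+1%:R ^+ 2 =
      \sum_(1 <= k < n.+1) root4 R k / k%:R ^+ 2 by rewrite [RHS]big_add1.
  case: n => [|n]; first by rewrite big_geq.
  apply: le_trans (sum_root4_div_sqr n) _.
  have : 0 <= (root4 R n.+1)^-1 by rewrite invr_ge0 root4_ge0.
  lra.
have cvg_a : a n.+1 @[n --> \oo] --> (0 : R).
  have cvgD : D * (root4 R n.+1)^-1 @[n --> \oo] --> (0 : R).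
    rewrite -(mulr0 D); apply: cvgM; first exact: cvg_cst.
    have := @invf_root4_cvg0 R; rewrite -(cvg_shiftS (fun n => (root4 R n)^-1)).
    exact.
  apply: (squeeze_cvgr _ (@cvg_cst _ (0 : R) _ _ _) cvgD); near=> n.
  have /andP[-> le_a] := aD n => /=; apply: le_trans le_a _.
  by rewrite ler_wpM2l// root4_div_le.
have cvg_sa : (-1) ^+ n * a n.+1 @[n --> \oo] --> (0 : R).
  apply: norm_cvg0; have := cvg_a => /cvg_norm; rewrite normr0.
  by under [in X in _ -> X]eq_fun do rewrite normrM normrX normrN1 expr1n mul1r.
have partial N : \sum_(1 <= m < N.+1) (-1) ^+ m * a m =
    2^-1 * (series d N - a 1%N + (-1) ^+ N * a N.+1).
  elim: N => [|N IH]; first by rewrite big_geq// /series /= big_geq// expr0; ring.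
  by rewrite big_nat_recr//= IH /series /= big_nat_recr//= /d !exprS; field.
have cvg_all : (fun N => \sum_(1 <= m < N.+1) (-1) ^+ m * a m) @ \oo -->
    2^-1 * (limn (series d) - a 1%N + 0).
  under eq_fun do rewrite partial.
  apply: cvgM; first exact: cvg_cst.
  by apply: cvgD => //; apply: cvgB => //; exact: cvg_cst.
exact: cvgP cvg_all.
Unshelve. all: by end_near. Qed.

End AlternatingSeries.

Section TbarConvergence.
Variable R : realType.

Definition tb_inner (rk : seq nat) (m : nat) : R :=
  if rk is [::] then 1 else \sum_(1 <= n < m) tb R rk n.

Lemma tb_cons k rk m : tb R (k :: rk) m =
  (((2 * m - (size rk).+1)%N%:R) ^+ k)^-1 * tb_inner rk m.
Proof. by []. Qed.

Lemma tb_ge0 rk m : 0 <= tb R rk m.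
Proof.
elim: rk m => [|k rk IH] m //; rewrite tb_cons mulr_ge0 ?invr_ge0 ?exprn_ge0//.
by rewrite /tb_inner; case: rk IH => // *; apply: sumr_ge0.
Qed.

Lemma tb_inner_ge0 rk m : 0 <= tb_inner rk m.
Proof.
by rewrite /tb_inner; case: rk => // *; apply: sumr_ge0 => n _; exact: tb_ge0.
Qed.

Lemma inv_shift_le (j k m : nat) : (0 < k)%N ->
  (((2 * m.+1 - j.+1)%N%:R : R) ^+ k)^-1 <= j.+1%:R / m.+1%:R.
Proof.
case: k => // k _; case: (posnP (2 * m.+1 - j.+1)%N) => [->|x0].
  by rewrite expr0n invr0 divr_ge0.
apply: (@le_trans _ _ ((2 * m.+1 - j.+1)%N%:R^-1)).
  by rewrite lef_pV2 ?posrE ?exprn_gt0 ?ltr0n// exprS ler_peMr// exprn_ege1// ler1n.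
rewrite ler_pdivlMr ?ltr0n// ler_pdivrMl ?ltr0n// -natrM ler_nat.
by case: (leqP j.+1 m.+1) => h; nia.
Qed.

Lemma ler_subX (a b : R) k : 0 <= b -> b <= a -> a <= 1 ->
  a ^+ k - b ^+ k <= k%:R * (a - b).
Proof.
move=> b0 ba a1; elim: k => [|k IH]; first by rewrite !expr0 subrr mul0r.
have ak : a ^+ k <= 1 by rewrite exprn_ile1//; exact: le_trans ba.
have a0 : 0 <= a by exact: le_trans ba.
have ab : 0 <= a ^+ k - b ^+ k by rewrite subr_ge0 lerXn2r ?nnegrE.
have -> : a ^+ k.+1 - b ^+ k.+1 = a ^+ k * (a - b) + b * (a ^+ k - b ^+ k).
  by rewrite !exprS; ring.
have h1 : a ^+ k * (a - b) <= a - b by rewrite ler_piMl ?subr_ge0.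
have h2 : b * (a ^+ k - b ^+ k) <= a ^+ k - b ^+ k.
  by rewrite ler_piMl//; exact: le_trans a1.
by rewrite -natr1; lra.
Qed.

Lemma inv_shift_diff_le (j k m : nat) : (0 < k)%N ->
  `|(((2 * m.+1 - j.+1)%N%:R : R) ^+ k)^-1 -
    (((2 * m.+2 - j.+1)%N%:R : R) ^+ k)^-1| <=
  (2 * k%:R + 1) * j.+1%:R ^+ 2 / m.+1%:R ^+ 2.
Proof.
move=> k0; have inv_le1 x : 0 <= ((x%:R : R) ^+ k)^-1 <= 1.
  rewrite invr_ge0 exprn_ge0//=; case: (posnP x) => [->|x0].
    by rewrite expr0n gtn_eqF// invr0.
  by rewrite invf_le1 ?exprn_gt0 ?ltr0n// exprn_ege1// ler1n.
case: (posnP (2 * m.+1 - j.+1)%N) => [e|x0].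
  rewrite e expr0n gtn_eqF// invr0 sub0r normrN ger0_norm; last first.
    by have /andP[] := inv_le1 (2 * m.+2 - j.+1)%N.
  apply: le_trans (proj2 (andP (inv_le1 (2 * m.+2 - j.+1)%N))) _.
  rewrite ler_pdivlMr ?exprn_gt0 ?ltr0n// mul1r.
  apply: (@le_trans _ _ (j.+1%:R ^+ 2)).
    by rewrite lerXn2r ?nnegrE// ler_nat; lia.
  by rewrite ler_peMl ?sqr_ge0// lerDr mulr_ge0.
have -> : (2 * m.+2 - j.+1 = (2 * m.+1 - j.+1) + 2)%N by lia.
have mx : (m.+1 <= j.+1 * (2 * m.+1 - j.+1))%N.
  by case: (leqP j.+1 m.+1) => h; nia.
move: (2 * m.+1 - j.+1)%N x0 mx => x x0 mx.
have x0' : 0 < x%:R :> R by rewrite ltr0n.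
have y0 : 0 < (x + 2)%N%:R :> R by rewrite ltr0n addn2.
have le_inv : ((x + 2)%N%:R : R)^-1 <= x%:R^-1.
  by rewrite lef_pV2 ?posrE// ler_nat leq_addr.
rewrite -!exprVn ger0_norm; last first.
  by rewrite subr_ge0 lerXn2r ?nnegrE ?invr_ge0.
have iy0 : 0 <= ((x + 2)%N%:R : R)^-1 by rewrite invr_ge0.
have ix1 : (x%:R : R)^-1 <= 1 by rewrite invf_le1// ler1n.
apply: le_trans (ler_subX k iy0 le_inv ix1) _.
have -> : x%:R^-1 - ((x + 2)%N%:R)^-1 = 2 / (x%:R * (x + 2)%N%:R) :> R.
  by rewrite natrD; field; rewrite -natrD !gt_eqF.
apply: (@le_trans _ _ (2 * k%:R * (x%:R ^+ 2)^-1)).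
  rewrite mulrA [k%:R * 2]mulrC ler_wpM2l ?mulr_ge0//.
  by rewrite lef_pV2 ?posrE ?mulr_gt0// expr2 ler_wpM2l ?ler_nat ?leq_addr.
rewrite -[leRHS]mulrA; apply: ler_pM; rewrite ?mulr_ge0 ?invr_ge0 ?sqr_ge0//.
  by rewrite lerDl.
rewrite exprVn ler_pdivlMr ?exprn_gt0 ?ltr0n// ler_pdivrMl ?exprn_gt0//.
by rewrite -exprMn -natrM lerXn2r ?nnegrE// ler_nat mulnC.
Qed.

Lemma tb_inner_bound rk : (exists2 C, 0 <= C & forall m, (rk != [::]) ->
    tb R rk m.+1 <= C * (root4 R m.+1 / m.+1%:R)) ->
  exists2 C, 0 <= C & forall m, tb_inner rk m.+1 <= C * root4 R m.+1.
Proof.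
case: rk => [_|k rk [C C0 bC]].
  by exists 1 => // m; rewrite mul1r; exact: root4_ge1.
exists (C * 4); first by rewrite mulr_ge0.
move=> m; rewrite /tb_inner big_add1 /=.
apply: le_trans (ler_sum_nat (fun i _ => bC i isT)) _.
rewrite -mulr_sumr -mulrA ler_wpM2l//.
apply: le_trans (_ : 4 * root4 R m <= _); last by rewrite ler_wpM2l// root4_le.
apply: le_trans (sum_root4_div R m).
by rewrite big_ord_recl root4_0 mul0r add0r big_mkord.
Qed.

Lemma tb_bound rk : all (ltn 0) rk -> exists2 C, 0 <= C & forall m, (rk != [::]) ->
  tb R rk m.+1 <= C * (root4 R m.+1 / m.+1%:R).
Proof.
elim: rk => [_|k rk IH /andP[k0 /IH /tb_inner_bound [C C0 bC]]].
  by exists 0.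
exists ((size rk).+1%:R * C); first by rewrite mulr_ge0.
move=> m _; rewrite tb_cons.
have -> : (size rk).+1%:R * C * (root4 R m.+1 / m.+1%:R) =
  (size rk).+1%:R / m.+1%:R * (C * root4 R m.+1) by ring.
apply: ler_pM; rewrite ?invr_ge0 ?exprn_ge0 ?tb_inner_ge0//.
exact: inv_shift_le.
Qed.

Lemma tb_variation k rk : all (ltn 0) (k :: rk) -> exists2 C, 0 <= C & forall m,
  `|tb R (k :: rk) m.+1 - tb R (k :: rk) m.+2| <=
  C * (root4 R m.+1 / m.+1%:R ^+ 2).
Proof.
move=> /andP[k0 rk0]; have [C C0 bC] := tb_inner_bound (tb_bound rk0).
have [D D0 bD] := tb_bound rk0.
pose j := (size rk).+1.
exists ((2 * k%:R + 1) * j%:R ^+ 2 * C + j%:R * D).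
  by rewrite !(addr_ge0, mulr_ge0, sqr_ge0).
move=> m; rewrite !tb_cons -/j.
set g1 := _^-1; set g2 := (_ ^+ k)^-1.
have -> : g1 * tb_inner rk m.+1 - g2 * tb_inner rk m.+2 =
   (g1 - g2) * tb_inner rk m.+1 - g2 * (tb_inner rk m.+2 - tb_inner rk m.+1) by ring.
have S1 := tb_inner_ge0 rk m.+1.
have g20 : 0 <= g2 by rewrite invr_ge0 exprn_ge0.
have dS : 0 <= tb_inner rk m.+2 - tb_inner rk m.+1 <= D * (root4 R m.+1 / m.+1%:R).
  case: (rk) bD => [|k' rk'] bD.
    by rewrite subrr lexx/= mulr_ge0// divr_ge0// root4_ge0.
  rewrite /tb_inner [X in X - _]big_nat_recr// addrAC subrr add0r.
  by rewrite tb_ge0 bD.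
have /andP[dS0 dSD] := dS.
apply: le_trans (ler_normB _ _) _.
rewrite normrM (ger0_norm S1) [`|g2 * _|]ger0_norm ?mulr_ge0// mulrDl lerD//.
  have -> : (2 * k%:R + 1) * j%:R ^+ 2 * C * (root4 R m.+1 / m.+1%:R ^+ 2) =
    (2 * k%:R + 1) * j%:R ^+ 2 / m.+1%:R ^+ 2 * (C * root4 R m.+1) by ring.
  by apply: ler_pM => //; exact: inv_shift_diff_le.
have -> : j%:R * D * (root4 R m.+1 / m.+1%:R ^+ 2) =
    j%:R / m.+1%:R * (D * (root4 R m.+1 / m.+1%:R)) by rewrite expr2 invfM; ring.
apply: ler_pM => //.
apply: le_trans (inv_shift_le _ _ k0) _.
by rewrite ler_wpM2l// lef_pV2 ?posrE ?ltr0n// ler_nat.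
Qed.

Lemma tb_series_cvg rk : all (ltn 0) rk -> rk != [::] ->
  cvgn (fun N => \sum_(1 <= m < N.+1) (-1) ^+ m * tb R rk m).
Proof.
case: rk => // k rk rk0 _; have [C C0 bC] := tb_variation rk0.
have [D _ bD] := tb_bound rk0.
apply: (@alternating_series_cvg _ (tb R (k :: rk)) C D C0) => // m.
by apply/andP; split; [exact: tb_ge0|exact: bD].
Qed.

End TbarConvergence.

Section Compositions.
Variable R : realType.

Definition composition (k : nat) (s : seq nat) :=
  all (fun x => 0 < x)%N s && (sumn s == k).

Definition tb_comp (K r q n : nat) : R :=
  \sum_(t : r.-tuple 'I_K | composition (q + r) (map val t)) tb R (map val t) n.

Definition tb_inner_comp (K r q n : nat) : R :=
  \sum_(t : r.-tuple 'I_K | composition (q + r) (map val t))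
    tb_inner R (map val t) n.

Lemma sumn_pos_ge (s : seq nat) : all (fun x => 0 < x)%N s -> (size s <= sumn s)%N.
Proof. by elim: s => //= x s IH /andP[x0 /IH]; lia. Qed.

Lemma tb_comp_rec K r q n : (q + r.+1 < K)%N -> tb_comp K r.+1 q n =
  \sum_(i < q.+1) (((2 * n - r.+1)%N%:R : R) ^+ i.+1)^-1 * tb_inner_comp K r (q - i) n.
Proof.
move=> qrK.
rewrite /tb_comp (sum_tuple_cons _ _ (composition (q + r.+1)) (fun s => tb R s n)).
pose G x : R := \sum_(t : r.-tuple 'I_K | composition (q + r.+1) (x :: map val t))
  tb R (x :: map val t) n.
rewrite -(big_mkord xpredT G) (big_cat_nat (n := q.+2)) //=; last by lia.
rewrite [X in _ + X]big_nat [X in _ + X]big1 ?addr0 => [|x /andP[qx _]]; last first.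
  apply: big_pred0 => t; apply/negP => /andP[/= /andP[_ /sumn_pos_ge]].
  by rewrite size_map size_tuple => le_r /eqP; lia.
rewrite big_nat_recl// [G 0%N]big_pred0 ?add0r; last by move=> t.
rewrite big_mkord; apply: eq_bigr => i _.
rewrite /G /tb_inner_comp mulr_sumr; apply: eq_big => [t|t _]; last first.
  by rewrite tb_cons size_map size_tuple.
rewrite /composition /=; congr (_ && _).
have iq : (i <= q)%N by rewrite -ltnS.
by apply/eqP/eqP; lia.
Qed.

Lemma chain_sum_comp r q n : (0 < n)%N ->
  (-1) ^+ (n + r).+1 * chain_sum R r q (2 * n - r.+1) =
  if r is 0 then (q == 0)%:R
  else \sum_(1 <= n' < n) (-1) ^+ (n' + r) * chain R r q (2 * n' - r).
Proof.
elim: n => // n IH _; case: n IH => [_|n IH].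
  case: r => [|r]; last first.
    have -> : (2 * 1 - r.+2 = 0)%N by lia.
    by rewrite big_geq// chain_sum0 mulr0.
  by rewrite muln1 chain_sum1 /chain /= andbT sqrrN expr1n mul1r.
have {}IH := IH isT.
case: r IH => [|r] IH.
  have -> : (2 * n.+2 - 1 = (2 * n.+1 - 1).+2)%N by lia.
  rewrite chain_sumSS [chain R 0 _ _](_ : _ = 0); last by rewrite /chain /= andbF.
  by rewrite sub0r -[RHS]IH addSn exprS; ring.
rewrite big_nat_recr//= -IH.
case: (leqP r.+2 (2 * n.+1)) => h.
  have -> : (2 * n.+2 - r.+2 = (2 * n.+1 - r.+2).+2)%N by lia.
  rewrite chain_sumSS.
  have -> : ((2 * n.+1 - r.+2).+1 = 2 * n.+1 - r.+1)%N by lia.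
  have -> : (n.+2 + r.+1 = (n.+1 + r.+1).+1)%N by [].
  by move: (n.+1 + r.+1)%N => e; rewrite !exprS; ring.
have -> : (2 * n.+1 - r.+2 = 0)%N by lia.
have -> : (2 * n.+1 - r.+1 = 0)%N by lia.
rewrite chain_sum0 chain0 !mulr0 addr0.
have [->|->] : (2 * n.+2 - r.+2 = 0 \/ 2 * n.+2 - r.+2 = 1)%N by lia.
  by rewrite chain_sum0 mulr0.
by rewrite chain_sum1 chain0 mulr0.
Qed.

Lemma tb_comp_chain K r q n : (q + r.+1 < K)%N -> (0 < n)%N ->
  2 ^+ r.+1 * tb_comp K r.+1 q n =
  (-1) ^+ (n + r.+1) * chain R r.+1 q (2 * n - r.+1).
Proof.
elim: r q n => [|r IH] q n qK n0; rewrite tb_comp_rec// chainS !mulr_sumr;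
    apply: eq_bigr => i _.
  have -> : (-1) ^+ (n + 1) * (2 / (2 * n - 1)%:R ^+ i.+1 *
      chain_sum R 0 (q - i) (2 * n - 1)) = 2 / (2 * n - 1)%:R ^+ i.+1 *
      ((-1) ^+ (n + 0).+1 * chain_sum R 0 (q - i) (2 * n - 1)).
    by rewrite addn1 addn0; ring.
  rewrite chain_sum_comp// expr1 mulrA; congr (_ * _).
  rewrite /tb_inner_comp big_mkcond (big_pred1 [tuple]) /=; last first.
    by move=> t; rewrite /= (tuple0 t); exact/esym/eqP.
  by rewrite /composition /= addn0 eq_sym; case: eqP.
have -> : (-1) ^+ (n + r.+2) * (2 / (2 * n - r.+2)%:R ^+ i.+1 *
      chain_sum R r.+1 (q - i) (2 * n - r.+2)) = 2 / (2 * n - r.+2)%:R ^+ i.+1 *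
      ((-1) ^+ (n + r.+1).+1 * chain_sum R r.+1 (q - i) (2 * n - r.+2)).
  by rewrite addnS; ring.
rewrite chain_sum_comp// exprS.
have -> : 2 * 2 ^+ r.+1 * (((2 * n - r.+2)%:R ^+ i.+1)^-1 * tb_inner_comp K r.+1 (q - i) n)
   = 2 / (2 * n - r.+2)%:R ^+ i.+1 * (2 ^+ r.+1 * tb_inner_comp K r.+1 (q - i) n).
  by ring.
congr (_ * _).
have -> : tb_inner_comp K r.+1 (q - i) n = \sum_(1 <= n' < n) tb_comp K r.+1 (q - i) n'.
  rewrite /tb_inner_comp /tb_comp [RHS]exchange_big /=; apply: eq_bigr => t _.
  by case/tupleP: t => x t.
rewrite mulr_sumr; apply: eq_big_nat => n' /andP[n'0 _].
by rewrite IH//; have := ltn_ord i; lia.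
Qed.

Lemma W_cvg r q :
  \sum_(1 <= n < N.+1) (-1) ^+ r.+1 * chain R r.+1 q (2 * n - r.+1) @[N --> \oo]
    --> W R (q + r.+1) r.+1.
Proof.
have cvg_t (t : r.+1.-tuple 'I_(q + r.+1).+1) :
    composition (q + r.+1) (map val t) ->
    2 ^+ r.+1 * (\sum_(1 <= n < N.+1) (-1) ^+ n * tb R (rev (map val t)) n)
      @[N --> \oo] --> Tbar R (map val t).
  move=> /andP[t0 _]; rewrite /Tbar size_map size_tuple.
  apply: cvgM; first exact: cvg_cst.
  apply: tb_series_cvg; first by rewrite all_rev.
  by rewrite -size_eq0 size_rev size_map size_tuple.
have cvg_s (s : seq (r.+1.-tuple 'I_(q + r.+1).+1)) :
    \sum_(t <- s | composition (q + r.+1) (map val t)) 2 ^+ r.+1 *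
      (\sum_(1 <= n < N.+1) (-1) ^+ n * tb R (rev (map val t)) n) @[N --> \oo] -->
    \sum_(t <- s | composition (q + r.+1) (map val t)) Tbar R (map val t).
  elim: s => [|t s IH].
    by rewrite big_nil; under eq_fun do rewrite big_nil; exact: cvg_cst.
  rewrite big_cons; under eq_fun do rewrite big_cons.
  by case: ifP => // ct; apply: cvgD => //; exact: cvg_t.
have := cvg_s (index_enum _); rewrite -/(W R (q + r.+1) r.+1).
apply: cvg_trans; apply: near_eq_cvg; near=> N.
rewrite -mulr_sumr exchange_big /= mulr_sumr; apply: eq_big_nat => n /andP[n0 _].
rewrite -mulr_sumr mulrCA.
have -> : \sum_(t : r.+1.-tuple 'I_(q + r.+1).+1 | composition (q + r.+1) (map val t))
    tb R (rev (map val t)) n = tb_comp (q + r.+1).+1 r.+1 q n.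
  pose f (t : r.+1.-tuple 'I_(q + r.+1).+1) := [tuple of rev t].
  have fK : involutive f by move=> t; apply: val_inj; rewrite /= revK.
  rewrite /tb_comp [RHS](reindex_inj (inv_inj fK)) /=.
  apply: eq_big => [t|t _]; rewrite map_rev ?revK//.
  by rewrite /composition all_rev sumn_rev.
rewrite tb_comp_chain// mulrA -exprD; congr (_ * _).
by rewrite addnA addnn -muln2 exprD exprM sqrr_sign mul1r.
Unshelve. all: by end_near. Qed.

Lemma even_sum_chain m q (f : nat -> R) N : (0 < m)%N ->
  \sum_(k < (2 * N).+1) chain R (2 * m) q k * f k =
  \sum_(1 <= n < N.+1) chain R (2 * m) q (2 * n) * f (2 * n)%N.
Proof.
move=> m0; have m1 : (2 * m = (2 * m).-1.+1)%N by lia.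
rewrite big_ord_recl [X in chain R X _ ord0]m1 chain0 mul0r add0r.
under eq_bigr => i _ do rewrite lift0.
rewrite (sum_ord_double (fun k => chain R (2 * m) q k.+1 * f k.+1)).
apply: eq_big_nat => n /andP[n0 _].
rewrite (@chain_parity R _ _ (2 * n - 2).+1); last by lia.
by rewrite mul0r add0r; have -> : ((2 * n - 1).+1 = 2 * n)%N by lia.
Qed.

Lemma shifted_even_sum_chain m q N : (0 < m)%N ->
  \sum_(1 <= n < (N + m).+1) chain R (2 * m) q (2 * n - 2 * m) =
  \sum_(k < (2 * N).+1) chain R (2 * m) q k.
Proof.
move=> m0; have m1 : ((2 * m).-1.+1 = 2 * m)%N by lia.
rewrite (big_cat_nat (n := m.+1)) //=; last by rewrite ltnS leq_addl.
rewrite [X in X + _]big_nat [X in X + _]big1 ?add0r => [|n /andP[n0 nm]]; last first.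
  have -> : (2 * n - 2 * m = 0)%N by lia.
  by rewrite -m1 chain0.
transitivity (\sum_(k < (2 * N).+1) chain R (2 * m) q k * 1); last first.
  by apply: eq_bigr => k _; rewrite mulr1.
rewrite (even_sum_chain _ (fun=> 1))// -(add1n m) -addSn big_addn addnK.
by apply: eq_big_nat => n _; rewrite mulr1; congr (chain _ _ _ _); lia.
Qed.

Lemma W_even_cvg m q : (0 < m)%N ->
  \sum_(k < (2 * N).+1) chain R (2 * m) q k @[N --> \oo] --> W R (q + 2 * m) (2 * m).
Proof.
move=> m0; have m1 : ((2 * m).-1.+1 = 2 * m)%N by lia.
have := @W_cvg (2 * m).-1 q; rewrite m1 -(cvg_shiftn m) => cvgW.
apply: cvg_trans cvgW; apply: near_eq_cvg; near=> N => /=.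
rewrite exprM sqrrN !expr1n -shifted_even_sum_chain//.
by apply: eq_bigr => n _; rewrite mul1r.
Unshelve. all: by end_near. Qed.

End Compositions.

Section MomentLimit.
Variable R : realType.

Lemma moment_chain_cvg m q : (0 < m)%N ->
  \sum_(1 <= n < N.+1) chain R (2 * m) 0 (2 * n) * tanh_moment R (2 * n) q
    @[N --> \oo] --> W R (q + 2 * m) (2 * m).
Proof.
move=> m0; have m1 : ((2 * m).-1.+1 = 2 * m)%N by lia.
have cvg_double : (fun N : nat => 2 * N)%N @ \oo --> \oo.
  by apply/cvgnyPge => A; near=> N; rewrite (@leq_trans N) ?leq_pmull//;
     near: N; exact: nbhs_infty_ge.
have cvg0 := cvg_comp _ _ cvg_double (@transport_cvg0 R (2 * m).-1 q).
rewrite m1 in cvg0.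
rewrite -[X in _ --> X]add0r; apply: cvg_trans (cvgD cvg0 (@W_even_cvg R m q m0)).
apply: near_eq_cvg; near=> N.
by rewrite !fctE /= subrK (even_sum_chain _ (fun k => tanh_moment R k q)).
Unshelve. all: by end_near. Qed.

End MomentLimit.

Theorem mainTheorem8 (R : realType) (m p : nat) :
  (0 < m)%N -> (0 < p)%N ->
  (fun N : nat => \sum_(1 <= n < N.+1)
       Tones R n m * Tones R n p / n%:R * (-1) ^+ n)
    @ \oo -->
  (-1) ^+ m * \sum_(1 <= j < p.+1)
       W R (2 * j + 2 * m - 1) (2 * m) * Z R j p.
Proof.
move=> m0 p0.
have summand n : (0 < n)%N ->
    Tones R n m * Tones R n p / n%:R * (-1) ^+ n =
    (-1) ^+ m * \sum_(1 <= j < p.+1) chain R (2 * m) 0 (2 * n) *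
       tanh_moment R (2 * n) (2 * j - 1) * Z R j p.
  case: n => // n _; rewrite chain_even_Tones//.
  under eq_bigr do rewrite -mulrA.
  rewrite -mulr_sumr -Tones_tanh_moment// exprD.
  have sgn2 : (-1) ^+ m * (-1) ^+ m = 1 :> R by rewrite -expr2 sqrr_sign.
  rewrite -[LHS]mul1r -[X in X * _ = _]sgn2; ring.
have cvg_sum s : \sum_(j <- s) (\sum_(1 <= n < N.+1) chain R (2 * m) 0 (2 * n) *
      tanh_moment R (2 * n) (2 * j.+1 - 1)) * Z R j.+1 p @[N --> \oo] -->
    \sum_(j <- s) W R (2 * j.+1 + 2 * m - 1) (2 * m) * Z R j.+1 p.
  elim: s => [|j s IH].
    by rewrite big_nil; under eq_fun do rewrite big_nil; exact: cvg_cst.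
  rewrite big_cons; under eq_fun do rewrite big_cons.
  apply: cvgD => //; apply: cvgM; last exact: cvg_cst.
  have -> : (2 * j.+1 + 2 * m - 1 = 2 * j.+1 - 1 + 2 * m)%N by lia.
  exact: moment_chain_cvg.
rewrite big_add1 /=.
apply: cvg_trans (cvgM (@cvg_cst _ ((-1) ^+ m : R) _ \oo _)
  (cvg_sum (index_iota 0 p))).
apply: near_eq_cvg; near=> N.
rewrite [RHS](eq_big_nat _ _ (fun n h => summand n (proj1 (andP h)))).
rewrite -mulr_sumr exchange_big /= [in RHS]big_add1 /=; congr (_ * _).
by apply: eq_bigr => j _; rewrite mulr_suml.
Unshelve. all: by end_near. Qed.
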